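(* Let $\mathcal A':f'=0$ be an (essential) line arrangement in $\mathbb P^2$ with $d'$ lines, let $p$ be an intersection point of $\mathcal A'$ of maximal multiplicity $m'$, let $L$ be a generic line passing through $p$, and let $\mathcal A=\mathcal A'\cup L$. Put $r'=r(\mathcal A')$ and $r=r(\mathcal A)$. Then: (1) The weak combinatorics of $\mathcal A'$ determines the weak combinatorics of $\mathcal A$, and the combinatorics of $\mathcal A'$ (together with the point $p$) determines the combinatorics of $\mathcal A$. In particular, $\tau(\mathcal A)=\tau(\mathcal A')+d'+m'-1$. (2) $r=r'+1$ if $r'<d'-m'$. (3) $r=r'$ if $r'=d'-m'$.
   Context: $\mathbb K$ is a field of characteristic zero, $S=\mathbb K[x,y,z]$ with the standard grading. A line arrangement $\mathcal A$ in $\mathbb P^2$ is a finite set of distinct lines, given by $f=0$ with $f\in S$ a product of pairwise non-proportional linear forms; it is essential if the lines are not all concurrent. $r(\mathcal A)$ is the minimal degree $r$ for which there is a nonzero triple $(a,b,c)\in S_r^3$ with $af_x+bf_y+cf_z=0$. The multiplicity of a point is the number of lines of the arrangement through it; $n_j$ denotes the number of points of multiplicity $j\ge2$. The combinatorics of $\mathcal A$ is its intersection lattice $L(\mathcal A)$, the weak combinatorics is the collection of numbers $n_j$, $j\ge 2$, and the global Tjurina number is $\tau(\mathcal A)=\sum_{j\ge 2}n_j(j-1)^2$. A generic line through $p$ means a line $L\notin\mathcal A'$ through $p$ which contains no intersection point (point of multiplicity $\ge 2$) of $\mathcal A'$ other than $p$. *)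

(* Defs.v *)
From mathcomp Require Import all_boot all_order all_algebra.
From mathcomp Require Import finmap.
From mathcomp Require Import mpoly.

Set Implicit Arguments.
Unset Strict Implicit.
Unset Printing Implicit Defensive.

Import GRing.Theory.
Local Open Scope ring_scope.

(* Points and lines of the projective plane over K are the subspaces of K^3 of
   dimension 1 and 2 respectively; incidence is inclusion of subspaces. *)
Notation subspace3 K := {vspace 'rV[K]_3}.

Definition line_arrangement (K : fieldType) (A : {fset subspace3 K}) : Prop :=
  {in A, forall H, \dim H = 2%N}.

Definition concurrent (K : fieldType) (A : {fset subspace3 K}) : Prop :=
  exists p : subspace3 K, \dim p = 1%N /\ {in A, forall H, (p <= H)%VS}.

Definition essential (K : fieldType) (A : {fset subspace3 K}) : Prop :=
  ~ concurrent A.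

Definition defining_polynomial (K : fieldType) (A : {fset subspace3 K})
    (f : {mpoly K[3]}) : Prop :=
  exists l : subspace3 K -> {mpoly K[3]},
    [/\ {in A, forall H, l H \is 1.-homog},
        forall (H : subspace3 K) (v : 'rV[K]_3), H \in A ->
          (v \in H) = ((l H).@[v ord0] == 0)
      & f = \prod_(H <- enum_fset A) l H].

Definition multiplicity (K : fieldType) (A : {fset subspace3 K})
    (p : subspace3 K) : nat :=
  #|` [fset H in A | (p <= H)%VS]%fset|.

(* As a finite set: the pairwise intersections of distinct lines. These are
   the points of multiplicity at least 2, see [in_intersection_points]. *)
Definition intersection_points (K : fieldType) (A : {fset subspace3 K}) :
    {fset subspace3 K} :=
  [fset (HH.1 :&: HH.2)%VS | HH in [fset HH in A `*` A | HH.1 != HH.2]]%fset.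

Lemma in_intersection_points (K : fieldType) (A : {fset subspace3 K})
    (p : subspace3 K) :
  line_arrangement A ->
  (p \in intersection_points A) = (\dim p == 1%N) && (1 < multiplicity A p)%N.
Proof.
move=> arrA.
have dimI (H1 H2 : subspace3 K) : \dim H1 = 2%N -> \dim H2 = 2%N -> H1 != H2 ->
    \dim (H1 :&: H2)%VS = 1%N.
  move=> d1 d2 neq.
  have dsum := dimv_sum_cap H1 H2.
  have le3 : (\dim (H1 + H2) <= 3)%N.
    by rewrite (leq_trans (dimvS (subvf _))) // dimvf /dim /= mul1n.
  have le1 : (\dim (H1 :&: H2) <= 2)%N by apply: leq_trans (dimvS (capvSl H1 H2)) _; rewrite d1.
  have ne2 : \dim (H1 :&: H2)%VS <> 2%N.
    move=> d12; case/eqP: neq.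
    have /eqP <- : (H1 :&: H2 == H1)%VS by rewrite eqEdim capvSl d1 d12.
    by apply/eqP; rewrite eqEdim capvSr d2 d12.
  move: dsum le3 le1 ne2; rewrite d1 d2.
  by case: (\dim (H1 :&: H2)%VS) => [|[|[|b]]] //; rewrite addn0 => ->.
apply/imfsetP/andP => [[[H1 H2]] /= | [/eqP dp]].
  rewrite !inE /= => /andP[/andP[H1A H2A] neq] ->; split.
    by rewrite (dimI _ _ (arrA _ H1A) (arrA _ H2A) neq).
  have /fsubset_leq_card : ([fset H1; H2] `<=`
      [fset H in A | (H1 :&: H2 <= H)%VS])%fset.
    by apply/fsubsetP => H; rewrite !inE => /orP[]/eqP->;
      rewrite ?H1A ?H2A ?capvSl ?capvSr.
  by rewrite cardfs2 neq.
rewrite /multiplicity => gt1.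
have /fset0Pn[H1 H1in] : [fset H in A | (p <= H)%VS]%fset != fset0.
  by rewrite -cardfs_gt0 (leq_trans _ gt1).
have /fset0Pn[H2] : ([fset H in A | (p <= H)%VS] `\ H1)%fset != fset0.
  by rewrite -cardfs_gt0; move: gt1; rewrite (cardfsD1 H1) H1in.
move: H1in; rewrite !inE /= => /andP[H1A pH1] /and3P[neq H2A pH2].
exists (H1, H2) => /=; first by rewrite !inE /= H1A H2A eq_sym.
apply/eqP; rewrite eqEdim subv_cap pH1 pH2 dp.
by rewrite (dimI _ _ (arrA _ H1A) (arrA _ H2A)) // eq_sym.
Qed.

(* The number n_j; meaningful only for j >= 2. *)
Definition npoints (K : fieldType) (A : {fset subspace3 K}) (j : nat) : nat :=
  #|` [fset p in intersection_points A | multiplicity A p == j]%fset|.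

Definition same_weak_combinatorics (K : fieldType) (A B : {fset subspace3 K}) :
    Prop :=
  forall j : nat, (2 <= j)%N -> npoints A j = npoints B j.

(* No point has multiplicity larger than the number of lines. *)
Definition tjurina (K : fieldType) (A : {fset subspace3 K}) : nat :=
  (\sum_(2 <= j < #|` A|.+1) npoints A j * (j - 1) ^ 2)%N.

(* All intersections of subsets of A; the empty intersection is the whole
   space. *)
Definition intersection_lattice (K : fieldType) (A : {fset subspace3 K}) :
    {fset subspace3 K} :=
  [fset (\bigcap_(H <- enum_fset B) H)%VS | B : {fset subspace3 K} in fpowerset A]%fset.

(* Only the restriction of phi to the lattice of A matters. Preserving
   inclusion is the same as preserving reverse inclusion. *)
Definition lattice_isomorphism (K : fieldType) (A B : {fset subspace3 K})
    (phi : subspace3 K -> subspace3 K) : Prop :=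
  [/\ {in intersection_lattice A &, injective phi},
      [fset phi X | X in intersection_lattice A]%fset = intersection_lattice B
    & {in intersection_lattice A &, {mono phi : X Y / (X <= Y)%VS}}].

Definition same_combinatorics (K : fieldType) (A B : {fset subspace3 K}) : Prop :=
  exists phi : subspace3 K -> subspace3 K, lattice_isomorphism A B phi.

Definition same_pointed_combinatorics (K : fieldType)
    (A : {fset subspace3 K}) (p : subspace3 K)
    (B : {fset subspace3 K}) (q : subspace3 K) : Prop :=
  exists phi : subspace3 K -> subspace3 K,
    lattice_isomorphism A B phi /\ phi p = q.

Definition maximal_multiplicity_point (K : fieldType) (A : {fset subspace3 K})
    (p : subspace3 K) : Prop :=
  p \in intersection_points A /\
  {in intersection_points A, forall q, (multiplicity A q <= multiplicity A p)%N}.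

Definition generic_line_through (K : fieldType) (A : {fset subspace3 K})
    (p L : subspace3 K) : Prop :=
  [/\ \dim L = 2%N, L \notin A, (p <= L)%VS
    & {in intersection_points A, forall q, (q <= L)%VS -> q = p}].

Definition generic_extension_data (K : fieldType) (A : {fset subspace3 K})
    (p L : subspace3 K) : Prop :=
  [/\ line_arrangement A, essential A, maximal_multiplicity_point A p
    & generic_line_through A p L].

Definition has_syzygy (K : fieldType) (f : {mpoly K[3]}) (r : nat) : Prop :=
  exists g : 'I_3 -> {mpoly K[3]},
    [/\ forall i, g i \is r.-homog, exists i, g i != 0
      & \sum_(i < 3) g i * f^`M(i) = 0].

Definition minimal_syzygy_degree (K : fieldType) (f : {mpoly K[3]}) (r : nat) :
    Prop :=
  has_syzygy f r /\ forall s : nat, has_syzygy f s -> (r <= s)%N.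

(* Main.v *)
Require Import Defs.
From mathcomp Require Import all_boot all_order all_algebra.
From mathcomp Require Import finmap.
From mathcomp Require Import mpoly ring zify.
From Stdlib Require Import Classical_Prop.

(** Syzygies of the partial derivatives of f are vector fields killing f. Let l be
    the form of L, so that f = l f' up to a scalar, and let E be the Euler field.

    Adding suitable multiples of E relates the fields killing f and f': if g kills
    f', then l g - (g(l) / deg f) E kills f ([syzygy_addition]); if g kills l f', then
    l divides g(l) and g + (h / deg f') E, where g(l) = l h, kills f' and is tangent
    to L ([syzygy_deletion]). Hence r' <= r <= r' + 1.

    If r = r', there is a field g of degree r' killing f' and tangent to L. A field
    killing f' is tangent to every line of A', so at each of the d' - m' + 1 points
    where L meets A' the vector g(x) is tangent to two lines and is proportional to
    x. The 2 x 2 minors of (g, x) have degree r' + 1; when r' < d' - m' they have too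
    many zeros on L and vanish there. By Euler's formula l then divides g, and g / l
    is a syzygy of f' of degree r' - 1, a contradiction
    ([tangent_syzygy_multiple], [minimal_degree_increases]). So r = r' + 1.

    Conversely the derivative in the direction of p, times the product of the forms
    of the lines avoiding p and corrected by E, kills f. Its degree is d' - m', so
    r <= d' - m' ([central_syzygy]); this forces r = r' when r' = d' - m'.

    For the combinatorics, the points of A are those of A' together with d' - m'
    double points on L, and only the multiplicity of p changes
    ([extension_intersection_points]). Any sum of a function of the multiplicity over
    the points changes accordingly ([point_sum_extension]), which gives the Tjurina
    number; and m' and d' are determined by the weak combinatorics, as the largest
    multiplicity and through the number d' (d' - 1) of ordered pairs of lines. An
    isomorphism of lattices amounts to a bijection of lines preserving closures, and
    the closures in A can be expressed by those in A' and incidence with p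
    ([generic_meet_leP], [same_combinatorics_extension]). *)

Set Implicit Arguments.
Unset Strict Implicit.
Unset Printing Implicit Defensive.

Import GRing.Theory.
Local Open Scope ring_scope.

(** * Polynomial functions in characteristic zero *)

(** Uniqueness of base-N digits: it makes the substitution of powers of one
    variable in [mpoly_fun_eq0] injective on monomials. *)
Lemma kronecker_inj n N (a b : 'I_n -> nat) :
  (forall i, (a i < N)%N) -> (forall i, (b i < N)%N) ->
  (\sum_(i < n) a i * N ^ i = \sum_(i < n) b i * N ^ i)%N -> a =1 b.
Proof.
elim: n a b => [|n IHn] a b aN bN; first by move=> _ [].
have N_gt0 : (0 < N)%N by apply: leq_ltn_trans (aN ord0).
have shift (c : 'I_n.+1 -> nat) :
    (\sum_(i < n.+1) c i * N ^ i = (\sum_(i < n) c (lift ord0 i) * N ^ i) * N + c ord0)%N.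
  rewrite big_ord_recl muln1 addnC big_distrl /=; congr addn.
  by apply: eq_bigr => i _; rewrite expnSr mulnA.
rewrite !shift => e.
have e0 : a ord0 = b ord0.
  by have := congr1 (modn^~ N) e; rewrite /= !modnMDl !modn_small.
move: e; rewrite e0 => /addIn/eqP; rewrite eqn_pmul2r // => /eqP/IHn e.
move=> i; case: (unliftP ord0 i) => [j|] -> //.
by apply: e.
Qed.

Section CharacteristicZero.

Variables (K : fieldType) (charK : [pchar K] =i pred0).

Lemma natr_eq0_char0 k : (k%:R == 0 :> K) = (k == 0)%N.
Proof. by move/pcharf0P: charK => ->. Qed.

Lemma natr_inj_char0 : injective (fun k => k%:R : K).
Proof.
move=> a b; wlog le_ab : a b / (a <= b)%N => [th|] /= e.
  by case/orP: (leq_total a b) => /th; [apply | move=> -> //].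
apply/eqP; rewrite eqn_leq le_ab /= -subn_eq0 -natr_eq0_char0 natrB // e.
by rewrite subrr.
Qed.

Lemma poly_fun_eq0 (u : {poly K}) : (forall t, u.[t] = 0) -> u = 0.
Proof.
move=> u0; apply: (@roots_geq_poly_eq0 _ u [seq i%:R | i <- iota 0 (size u)]).
- by apply/allP => t _; rewrite /root u0.
- by rewrite map_inj_uniq ?iota_uniq //; apply: natr_inj_char0.
- by rewrite size_map size_iota.
Qed.

(** Kronecker substitution: replacing the i-th variable by t ^ (N ^ i), with N
    larger than all exponents, sends distinct monomials to distinct powers of t
    and reduces the claim to one variable. *)
Lemma mpoly_fun_eq0 n (p : {mpoly K[n]}) : (forall v, p.@[v] = 0) -> p = 0.
Proof.
move=> p0; pose N := (msize p).+1.
pose k (m : 'X_{1..n}) := (\sum_(i < n) m i * N ^ i)%N.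
pose u : {poly K} := \sum_(m <- msupp p) p@_m *: 'X^(k m).
have u0 : u = 0.
  apply: poly_fun_eq0 => t; rewrite -[RHS](p0 (fun i => t ^+ (N ^ i))) mevalE.
  rewrite /u horner_sum; apply: eq_bigr => m _.
  rewrite !hornerE; congr (_ * _); rewrite /k expr_sum.
  by apply: eq_bigr => i _; rewrite -exprM mulnC.
apply/mpolyP => m; rewrite mcoeff0.
case: (boolP (m \in msupp p)) => [mp|]; last exact: memN_msupp_eq0.
have : u`_(k m) = 0 by rewrite u0 coef0.
rewrite /u coef_sum (bigD1_seq m) ?msupp_uniq //= coefZ coefXn eqxx mulr1.
rewrite big_seq_cond big1 ?addr0 // => m' /andP[m'p neq].
rewrite coefZ coefXn; case: eqP => [e|_]; last by rewrite mulr0.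
have small q i : q \in msupp p -> (q i < N)%N.
  move=> /msize_mdeg_lt lt; rewrite /N ltnS; apply: leq_trans (ltnW lt).
  by rewrite mdegE (bigD1 i) //= leq_addr.
case/eqP: neq; apply/mnmP => i.
by apply: (@kronecker_inj n N) => [j|j|]; [exact: small|exact: small|].
Qed.

End CharacteristicZero.

(** * Derivations and divisibility by a linear form *)

(** A triple (a, b, c) is identified with the vector field of components a, b, c;
    a syzygy of the partial derivatives of f is then a field killing f. *)
Definition derivation (K : fieldType) n (g : 'I_n -> {mpoly K[n]})
    (f : {mpoly K[n]}) :=
  \sum_(i < n) g i * f^`M(i).

Section Derivations.

Variables (K : fieldType) (n : nat).
Implicit Types (g h : 'I_n -> {mpoly K[n]}) (f l : {mpoly K[n]}).

Notation euler_field := (fun i : 'I_n => 'X_i : {mpoly K[n]}).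

Lemma derivationM g f1 f2 :
  derivation g (f1 * f2) = derivation g f1 * f2 + f1 * derivation g f2.
Proof.
rewrite /derivation mulr_suml mulr_sumr -big_split /=; apply: eq_bigr => i _.
by rewrite mderivM; ring.
Qed.

Lemma derivationZr g c f : derivation g (c *: f) = c *: derivation g f.
Proof.
rewrite /derivation scaler_sumr; apply: eq_bigr => i _.
by rewrite mderivZ scalerAr.
Qed.

Lemma derivation_comb g h a b f :
  derivation (fun i => a * g i + b * h i) f =
  a * derivation g f + b * derivation h f.
Proof.
rewrite /derivation !mulr_sumr -big_split /=; apply: eq_bigr => i _; ring.
Qed.

(** The Euler field multiplies each monomial by its degree, so in characteristic
    zero homogeneity can be tested by a differential equation. *)
Lemma euler_coefficient f m :
  (derivation euler_field f)@_m = f@_m *+ mdeg m.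
Proof.
suff eX m' : derivation euler_field 'X_[m'] = 'X_[m'] *+ mdeg m'.
  have e : derivation euler_field f = \sum_(m' <- msupp f) f@_m' *: ('X_[m'] *+ mdeg m').
    rewrite {1}(mpolyE f) /derivation.
    under eq_bigr => i _ do rewrite raddf_sum mulr_sumr.
    rewrite exchange_big /=; apply: eq_bigr => m' _.
    by rewrite -eX -derivationZr /derivation.
  rewrite e [in RHS](mpolyE f) -mcoeffMn -sumrMnl !raddf_sum /=.
  apply: eq_bigr => m' _; rewrite mcoeffMn !mcoeffZ mcoeffMn !mcoeffX.
  by case: eqP => [->|_]; rewrite ?mulrnAr // ?(mul0rn, mulr0).
rewrite /derivation mdegE -sumrMnr; apply: eq_bigr => i _.
rewrite mderivX -scalerAr -mpolyXD.
case: (posnP (m' i)) => [->|mi_gt0]; first by rewrite scale0r.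
by rewrite addmC submK ?lep1mP -?lt0n // scaler_nat.
Qed.

Lemma euler_homog d f : f \is d.-homog -> derivation euler_field f = f *+ d.
Proof.
move=> hf; apply/mpolyP => m; rewrite euler_coefficient mcoeffMn.
case: (eqVneq (mdeg m) d) => [->//|neq].
by rewrite (dhomog_nemf_coeff hf neq) !mul0rn.
Qed.

Lemma homog_coefficient d f m : f \is d.-homog -> f@_m != 0 -> mdeg m = d.
Proof.
by move=> hf; apply: contraNeq => neq; rewrite (dhomog_nemf_coeff hf neq).
Qed.

Lemma mderiv_homog d f i : f \is d.-homog -> f^`M(i) \is d.-1.-homog.
Proof.
move=> hf; apply/dhomogP => m; rewrite mcoeff_msupp mcoeff_deriv => neq.
have /(homog_coefficient hf) : f@_(m + U_(i)) != 0.
  by apply: contraNneq neq => ->; rewrite mul0rn.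
by rewrite mdegD mdeg1 addn1 => <-.
Qed.

Lemma mderiv_linear_form l i : l \is 1.-homog -> l^`M(i) = (l@_U_(i))%:MP.
Proof.
move=> hl; apply/mpolyP => m; rewrite mcoeff_deriv mcoeffC.
case: (eqVneq 0%MM m) => [<-|neq].
  by rewrite add0m mulr1 mnm0E.
rewrite (dhomog_nemf_coeff hl) ?mul0rn ?mulr0 //=.
by rewrite /= mdegD mdeg1 addn1 eqSS mdeg_eq0 eq_sym.
Qed.

Lemma linear_formE l : l \is 1.-homog -> l = \sum_(i < n) l@_U_(i) *: 'X_i.
Proof.
move=> hl; rewrite -[LHS]mulr1n -(euler_homog hl); apply: eq_bigr => i _.
by rewrite (mderiv_linear_form _ hl) mulrC mul_mpolyC.
Qed.

Lemma meval_linear_form l (v : 'I_n -> K) :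
  l \is 1.-homog -> l.@[v] = \sum_(i < n) l@_U_(i) * v i.
Proof.
move=> hl; rewrite {1}(linear_formE hl) raddf_sum; apply: eq_bigr => i _ /=.
by rewrite mevalZ mevalXU.
Qed.

Lemma linear_form_neq0 l : l \is 1.-homog -> l != 0 -> exists j, l@_U_(j) != 0.
Proof.
move=> hl l0; apply/existsP; apply: contraNT l0 => /existsPn l0.
rewrite (linear_formE hl) big1 // => i _.
by have /negPn/eqP -> := l0 i; rewrite scale0r.
Qed.

End Derivations.

Section LinearDivision.

Variables (K : fieldType) (charK : [pchar K] =i pred0) (n : nat).
Implicit Types (f h l : {mpoly K[n]}).

Definition multiple l f := exists h, f = l * h.

Section Projection.

Variables (l : {mpoly K[n]}) (j : 'I_n).
Hypotheses (hl : l \is 1.-homog) (lj : l@_U_(j) != 0).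

(** The coordinates of the linear projection onto the kernel of l along the j-th
    axis. Substituting it is a ring morphism whose kernel is the ideal (l), which
    is how divisibility by l is handled below. *)
Definition projection : n.-tuple {mpoly K[n]} :=
  [tuple 'X_i - ((i == j)%:R / l@_U_(j)) *: l | i < n].

Lemma projection_form : l \mPo projection = 0.
Proof.
rewrite {1}(linear_formE hl) raddf_sum /=.
under eq_bigr => i _ do
  rewrite comp_mpolyZ comp_mpolyXU -tnth_nth tnth_mktuple scalerBr.
rewrite sumrB -(linear_formE hl) (bigD1 j) //= big1 ?addr0 => [|i /negPf ->].
  by rewrite eqxx scalerA mul1r divff // scale1r subrr.
by rewrite mul0r scale0r scaler0.
Qed.

Lemma sub_projection_multiple f : multiple l (f - (f \mPo projection)).
Proof.
elim/mpolyind: f => [|c m f _ _ [h e]].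
  by exists 0; rewrite comp_mpoly0 subr0 mulr0.
suff [h' e'] : multiple l ('X_[m] - ('X_[m] \mPo projection)).
  exists (c *: h' + h); rewrite comp_mpolyD comp_mpolyZ mulrDr -e -scalerAr -e'.
  by rewrite scalerBr opprD addrACA.
rewrite mpolyXE_id rmorph_prod /=.
elim/big_rec2: _ => [|i y1 y2 _ [h1 e1]].
  by exists 0; rewrite subrr mulr0.
suff [h2 e2] : multiple l ('X_i ^+ m i - ('X_i ^+ m i \mPo projection)).
  exists (h2 * y2 + ('X_i ^+ m i \mPo projection) * h1).
  move: e2; set a := 'X_i ^+ _; move: a (a \mPo _) => a b e2.
  have -> : l * (h2 * y2 + b * h1) = l * h2 * y2 + b * (l * h1) by ring.
  by rewrite -e1 -e2; ring.
rewrite rmorphXn /= comp_mpolyXU -tnth_nth tnth_mktuple subrXX.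
rewrite opprB addrC subrK -scalerAl scalerAr; eexists; reflexivity.
Qed.

Lemma multiple_projection f : multiple l f <-> f \mPo projection = 0.
Proof.
split=> [[h ->]|e]; first by rewrite rmorphM /= projection_form mul0r.
by have := sub_projection_multiple f; rewrite e subr0.
Qed.

End Projection.

Lemma multiple_prime l a b : l \is 1.-homog -> l != 0 ->
  multiple l (a * b) -> multiple l a \/ multiple l b.
Proof.
move=> hl /(linear_form_neq0 hl)[j lj]; rewrite !(multiple_projection hl lj).
by rewrite rmorphM /= => /eqP; rewrite mulf_eq0 => /orP[]/eqP; [left|right].
Qed.

(** The Nullstellensatz for a hyperplane: f composed with the projection vanishes
    as a function, hence as a polynomial. *)
Lemma vanishing_multiple l f : l \is 1.-homog -> l != 0 ->
  (forall v, l.@[v] = 0 -> f.@[v] = 0) -> multiple l f.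
Proof.
move=> hl /(linear_form_neq0 hl)[j lj] lf0.
apply/(multiple_projection hl lj); apply: mpoly_fun_eq0 => // v.
rewrite comp_mpoly_meval; apply: lf0.
by rewrite -comp_mpoly_meval (projection_form hl lj) meval0.
Qed.

(** Apply the Euler field to l * h and cancel l: every monomial of h is an
    eigenvector of the Euler field for the eigenvalue e - d. *)
Lemma quotient_coefficient l h d e m :
  l != 0 -> l \is d.-homog -> l * h \is e.-homog -> h@_m != 0 ->
  (d + mdeg m = e)%N.
Proof.
move=> l0 hl hlh hm; have := euler_homog hlh.
rewrite derivationM (euler_homog hl) mulrnAl -mulrnAr -mulrDr -mulrnAr.
move/(mulfI l0)/(congr1 (mcoeff m)).
rewrite mcoeffD !mcoeffMn euler_coefficient -mulrnDr.
rewrite -[_ *+ (_ + _)]mulr_natr -[RHS]mulr_natr => /(mulfI hm).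
exact: natr_inj_char0.
Qed.

Lemma quotient_homog l h d e :
  l != 0 -> l \is d.-homog -> l * h \is e.-homog -> h \is (e - d).-homog.
Proof.
move=> l0 hl hlh; apply/dhomogP => m; rewrite mcoeff_msupp => hm.
by rewrite -(quotient_coefficient l0 hl hlh hm) addKn.
Qed.

Lemma quotient_eq0 l h d e :
  l != 0 -> l \is d.-homog -> l * h \is e.-homog -> (e < d)%N -> h = 0.
Proof.
move=> l0 hl hlh lt_ed; apply/mpolyP => m; rewrite mcoeff0.
apply/eqP; apply: contraLR lt_ed => hm.
by rewrite -(quotient_coefficient l0 hl hlh hm) -leqNgt leq_addr.
Qed.

End LinearDivision.

(** * Syzygies of a product with a linear form *)

Section Syzygies.

Variables (K : fieldType) (charK : [pchar K] =i pred0).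

Notation euler_field := (fun i : 'I_3 => 'X_i : {mpoly K[3]}).

Lemma exists_neq0 (g : 'I_3 -> {mpoly K[3]}) :
  ((forall i, g i = 0) -> False) -> exists i, g i != 0.
Proof.
move=> th; apply/existsP; apply: contraT => /existsPn g0.
by case: th => i; have /negPn/eqP := g0 i.
Qed.

(** When e = 0 the quotient h vanishes, so that its degree e - 1 being truncated
    does no harm. *)
Lemma quotient_coordinate_homog (l h : {mpoly K[3]}) e i :
  l \is 1.-homog -> l != 0 -> l * h \is e.-homog -> h * 'X_i \is e.-homog.
Proof.
move=> hl l0 hlh; case: e hlh => [|e] hlh.
  by rewrite (quotient_eq0 charK l0 hl hlh) // mul0r dhomog0.
rewrite -[e.+1]addn1; apply: dhomogM; last by rewrite dhomogX /= mdeg1.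
by have := quotient_homog charK l0 hl hlh; rewrite subn1.
Qed.

Lemma derivation_linear_form_homog (g : 'I_3 -> {mpoly K[3]}) l e :
  l \is 1.-homog -> (forall i, g i \is e.-homog) ->
  derivation g l \is e.-homog.
Proof.
move=> hl hg; apply: rpred_sum => i _.
by rewrite (mderiv_linear_form _ hl) mulrC mul_mpolyC; apply: dhomogZ.
Qed.

(** If g kills l * f, then l divides g(l) because it is prime to f; writing
    g(l) = l * h one gets g(f) = - h * f, and adding h / deg f times the Euler
    field to g gives a field killing f. It is still tangent to l = 0, and it
    cannot vanish: otherwise g would be a multiple of the Euler field, which does
    not kill l * f. *)
Lemma syzygy_deletion (l f : {mpoly K[3]}) d r :
  l \is 1.-homog -> l != 0 -> f \is d.+1.-homog -> ~ multiple l f ->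
  has_syzygy (l * f) r ->
  exists g : 'I_3 -> {mpoly K[3]},
    [/\ forall i, g i \is r.-homog, exists i, g i != 0, derivation g f = 0
      & multiple l (derivation g l)].
Proof.
move=> hl l0 hf lNf [g [hg g0 gf]]; rewrite -/(derivation g (l * f)) in gf.
have f0 : f != 0 by apply: contra_notN lNf => /eqP ->; exists 0; rewrite mulr0.
have [h gl] : multiple l (derivation g l).
  have : multiple l (derivation g l * f).
    exists (- derivation g f); apply/eqP.
    by rewrite mulrN -addr_eq0 -derivationM gf.
  by case/(multiple_prime hl l0).
have gf' : derivation g f = - (h * f).
  apply/eqP; rewrite -addr_eq0; apply/eqP; apply: (mulfI l0).
  by rewrite mulr0 -gf derivationM gl; ring.
have dK : d.+1%:R != 0 :> K by rewrite natr_eq0_char0.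
have d2K : d.+2%:R != 0 :> K by rewrite natr_eq0_char0.
have hX i : h * 'X_i \is r.-homog.
  apply: (quotient_coordinate_homog _ hl l0); rewrite -gl.
  exact: derivation_linear_form_homog.
pose c : {mpoly K[3]} := (d.+1%:R^-1 : K)%:MP.
have cd : c *+ d.+1 = 1.
  by rewrite /c -mpolyCMn -(mulr_natr _^-1) mulVf.
pose g' i := 1 * g i + (c * h) * 'X_i.
exists g'; split.
- move=> i; by rewrite /g' mul1r -mulrA mul_mpolyC rpredD ?dhomogZ ?hX ?hg //.
- apply: (@exists_neq0 g') => g'0.
  have ge i : g i = - (c * h) * 'X_i + 0 * 0.
    have /eqP := g'0 i; rewrite /g' mul1r.
    by rewrite addr_eq0 => /eqP ->; ring.
  have h0 : h = 0.
    have := gf; rewrite {1}/derivation; under eq_bigr => i _ do rewrite ge.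
    rewrite -/(derivation (fun i => - (c * h) * 'X_i + 0 * 0) (l * f)).
    rewrite (derivation_comb euler_field (fun=> 0)) mul0r addr0.
    rewrite (euler_homog (dhomogM hl hf)) => /eqP.
    rewrite -mulr_natr !mulf_eq0 oppr_eq0 mulf_eq0 (negPf l0) (negPf f0) /=.
    rewrite -mpolyC_nat !mpolyC_eq0 add1n (negPf d2K) invr_eq0 (negPf dK) /=.
    by rewrite !orbF => /eqP.
  by case: g0 => i; rewrite ge h0 !mulr0 oppr0 mul0r addr0 eqxx.
- rewrite derivation_comb (euler_homog hf) gf'.
  have -> : c * h * (f *+ d.+1) = (c *+ d.+1) * (h * f) by ring.
  by rewrite cd; ring.
- exists (h + c * h); rewrite derivation_comb gl (euler_homog hl); ring.
Qed.

(** If g kills f, then l * g multiplies l * f by g(l); subtracting the matching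
    multiple of the Euler field corrects this. *)
Lemma syzygy_addition (l f : {mpoly K[3]}) d r :
  l \is 1.-homog -> l != 0 -> f \is d.+1.-homog -> f != 0 ->
  has_syzygy f r -> has_syzygy (l * f) r.+1.
Proof.
move=> hl l0 hf f0 [g [hg g0 gf]]; rewrite -/(derivation g f) in gf.
have dK : d.+1%:R != 0 :> K by rewrite natr_eq0_char0.
have d2K : d.+2%:R != 0 :> K by rewrite natr_eq0_char0.
pose c : {mpoly K[3]} := (d.+2%:R^-1 : K)%:MP.
have cd : c * d.+2%:R = 1.
  by rewrite mulr_natr /c -mpolyCMn -(mulr_natr _^-1) mulVf.
pose t := derivation g l.
pose g' i := l * g i + - (c * t) * 'X_i.
exists g'; split.
- have lg i : l * g i \is r.+1.-homog by rewrite -[r.+1]add1n dhomogM.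
  have tX i : t * 'X_i \is r.+1.-homog.
    rewrite -[r.+1]addn1; apply: dhomogM; last by rewrite dhomogX /= mdeg1.
    exact: derivation_linear_form_homog.
  move=> i; rewrite /g' mulNr -mulrA mul_mpolyC rpredD ?rpredN ?dhomogZ //.
- apply: (@exists_neq0 g') => g'0.
  have ge i : l * g i = (c * t) * 'X_i.
    have /eqP := g'0 i.
    by rewrite /g' mulNr subr_eq0 => /eqP.
  have t0 : t = 0.
    have : l * derivation g f = c * t * derivation euler_field f.
      rewrite /derivation [LHS]mulr_sumr [RHS]mulr_sumr; apply: eq_bigr => i _.
      by rewrite [LHS]mulrA ge [RHS]mulrA.
    rewrite gf mulr0 (euler_homog hf) => /esym/eqP.
    rewrite -mulr_natr !mulf_eq0 -mpolyC_nat !mpolyC_eq0 invr_eq0.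
    by rewrite (negPf dK) (negPf d2K) (negPf f0) !orbF => /eqP.
  case: g0 => i /negPf gi0; move/eqP: (ge i).
  by rewrite t0 mulr0 mul0r mulf_eq0 (negPf l0) gi0.
- rewrite -[LHS]/(derivation _ (l * f)) derivation_comb.
  rewrite (euler_homog (dhomogM hl hf)) derivationM gf mulr0 addr0 -/t.
  rewrite -mulr_natr add1n.
  have -> : - (c * t) * (l * f * d.+2%:R) = - (c * d.+2%:R) * (t * l * f) by ring.
  by rewrite cd; ring.
Qed.

End Syzygies.

(** * Forms cutting out lines *)

Section Forms.

Variables (K : fieldType) (charK : [pchar K] =i pred0).
Implicit Types (l f : {mpoly K[3]}) (H : subspace3 K) (v : 'rV[K]_3).

Definition cuts_out l H :=
  l \is 1.-homog /\ forall v, (v \in H) = (l.@[v ord0] == 0).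

Lemma dim_space3 : \dim (fullv : subspace3 K) = 3%N.
Proof. by rewrite dimvf /dim /= mul1n. Qed.

Lemma line_eq H1 H2 : \dim H1 = 2%N -> \dim H2 = 2%N -> (H1 <= H2)%VS -> H1 = H2.
Proof. by move=> d1 d2 le; apply/eqP; rewrite eqEdim le d1 d2. Qed.

Lemma cuts_out_neq0 l H : \dim H = 2%N -> cuts_out l H -> l != 0.
Proof.
move=> dH [_ lH]; apply/eqP => l0.
suff HT : H = fullv by move: dH; rewrite HT dim_space3.
by apply/vspaceP => v; rewrite memvf lH l0 meval0 eqxx.
Qed.

Lemma multiple_cut_out l H f : \dim H = 2%N -> cuts_out l H ->
  multiple l f <-> forall v, v \in H -> f.@[v ord0] = 0.
Proof.
move=> dH lH; have [hl eqH] := lH; split=> [[h ->] v|f0].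
  by rewrite eqH mevalM => /eqP ->; rewrite mul0r.
apply: vanishing_multiple => //; first exact: (cuts_out_neq0 dH lH).
move=> v lv; have evr g : g.@[v] = g.@[(\row_i v i : 'rV[K]_3) ord0].
  by apply: meval_eq => i; rewrite mxE.
by rewrite evr f0 // eqH -evr lv.
Qed.

Lemma multiple_forms l1 l2 H1 H2 : \dim H1 = 2%N -> \dim H2 = 2%N ->
  cuts_out l1 H1 -> cuts_out l2 H2 -> multiple l1 l2 -> H1 = H2.
Proof.
move=> d1 d2 c1 c2 /(multiple_cut_out _ d1 c1) l2H1; apply: line_eq => //.
by apply/subvP => v /l2H1 l2v; rewrite c2.2 l2v.
Qed.

Lemma cuts_out_unique l1 l2 H : \dim H = 2%N -> cuts_out l1 H -> cuts_out l2 H ->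
  exists2 c : K, c != 0 & l2 = c *: l1.
Proof.
move=> dH c1 c2; have l10 := cuts_out_neq0 dH c1; have l20 := cuts_out_neq0 dH c2.
have [h e] : multiple l1 l2.
  by apply/(multiple_cut_out _ dH c1) => v; rewrite c2.2 => /eqP.
have hh : h \is 0.-homog.
  have := c2.1; rewrite e => hl2.
  by have := quotient_homog charK l10 c1.1 hl2.
have eh : h = (h@_0)%:MP.
  apply/mpolyP => m; rewrite mcoeffC; case: eqVneq => [->|neq]; first by rewrite mulr1.
  by rewrite mulr0 (dhomog_nemf_coeff hh) //= mdeg_eq0.
exists h@_0; last by rewrite e {1}eh mulrC mul_mpolyC.
by apply: contraNneq l20 => h0; rewrite e eh h0 mulr0.
Qed.

Variable (l : subspace3 K -> {mpoly K[3]}).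

Lemma prod_forms_homog (s : seq (subspace3 K)) (P : pred (subspace3 K)) :
  {in s, forall H, l H \is 1.-homog} ->
  \prod_(H <- s | P H) l H \is (count P s).-homog.
Proof.
elim: s => [|H s IHs] hs; first by rewrite big_nil dhomog1.
have {}IHs : \prod_(H <- s | P H) l H \is (count P s).-homog.
  by apply: IHs => H' H's; apply: hs; rewrite in_cons H's orbT.
rewrite big_cons /=; case: ifP => // _.
by apply: dhomogM => //; apply: hs; rewrite mem_head.
Qed.

Lemma prod_arrangement_homog (A : {fset subspace3 K}) :
  {in A, forall H, cuts_out (l H) H} -> \prod_(H <- A) l H \is #|` A|.-homog.
Proof.
by move=> cA; rewrite -(count_predT A); apply: prod_forms_homog => H /cA[].
Qed.

Lemma prod_forms_neq0 (s : seq (subspace3 K)) (P : pred (subspace3 K)) :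
  {in s, forall H, \dim H = 2%N} -> {in s, forall H, cuts_out (l H) H} ->
  \prod_(H <- s | P H) l H != 0.
Proof.
move=> ds cs; rewrite big_seq_cond prodf_seq_neq0.
by apply/allP => H Hs; apply/implyP => _; apply: (cuts_out_neq0 (ds _ Hs) (cs _ Hs)).
Qed.

(** Linear forms are prime, and proportional only if they cut out the same line. *)
Lemma multiple_prod_forms l0 H0 (s : seq (subspace3 K)) (P : pred (subspace3 K)) :
  \dim H0 = 2%N -> cuts_out l0 H0 ->
  {in s, forall H, \dim H = 2%N} -> {in s, forall H, cuts_out (l H) H} ->
  multiple l0 (\prod_(H <- s | P H) l H) -> (H0 \in s) && P H0.
Proof.
move=> d0 c0; have l00 := cuts_out_neq0 d0 c0.
elim: s => [|H s IHs] ds cs.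
  rewrite big_nil => /(multiple_cut_out _ d0 c0)/(_ 0).
  by rewrite mem0v meval1 => /(_ isT)/eqP; rewrite oner_eq0.
have {}IHs : multiple l0 (\prod_(H <- s | P H) l H) -> (H0 \in s) && P H0.
  by apply: IHs => H' H's; [apply: ds|apply: cs]; rewrite in_cons H's orbT.
rewrite big_cons in_cons; case: ifP => [PH|_ /IHs/andP[-> ->]]; last by rewrite orbT.
case/(multiple_prime c0.1 l00) => [lH|/IHs/andP[-> ->]]; last by rewrite orbT.
have Hs : H \in H :: s by rewrite mem_head.
by rewrite (multiple_forms d0 (ds _ Hs) c0 (cs _ Hs) lH) eqxx PH.
Qed.

(** A syzygy of a product of distinct linear forms is tangent to each of the
    lines: l H is prime to the product of the other forms. *)
Lemma logarithmic (g : 'I_3 -> {mpoly K[3]}) (s : seq (subspace3 K)) H :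
  uniq s -> {in s, forall H, \dim H = 2%N} -> {in s, forall H, cuts_out (l H) H} ->
  derivation g (\prod_(H <- s) l H) = 0 -> H \in s ->
  multiple (l H) (derivation g (l H)).
Proof.
move=> us ds cs gf Hs; move: gf; rewrite (bigD1_seq H) //= derivationM => e.
have : multiple (l H) (derivation g (l H) * \prod_(H' <- s | H' != H) l H').
  exists (- derivation g (\prod_(H' <- s | H' != H) l H')); apply/eqP.
  by rewrite mulrN -addr_eq0 e.
case/(multiple_prime (cs _ Hs).1 (cuts_out_neq0 (ds _ Hs) (cs _ Hs))) => //.
by move/(multiple_prod_forms (ds _ Hs) (cs _ Hs) ds cs); rewrite eqxx andbF.
Qed.

End Forms.

(** * Lines, points and the generic line *)

Section PlaneGeometry.

Variable K : fieldType.
Implicit Types (A : {fset subspace3 K}) (H p q L : subspace3 K).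

Lemma dim_meet H1 H2 : \dim H1 = 2%N -> \dim H2 = 2%N -> H1 != H2 ->
  \dim (H1 :&: H2)%VS = 1%N.
Proof.
move=> d1 d2 neq; have := dimv_sum_cap H1 H2.
have le3 : (\dim (H1 + H2) <= 3)%N 
  by apply: leq_trans (dimvS (subvf _)) _; rewrite dim_space3.
have lt2 : (\dim (H1 :&: H2) < 2)%N.
  rewrite ltnNge; apply: contraNN neq => ge2; apply/eqP.
  have e1 : (H1 :&: H2)%VS = H1 by apply/eqP; rewrite eqEdim capvSl d1.
  by apply: line_eq => //; rewrite -e1 capvSr.
rewrite d1 d2; move: le3 lt2.
by move: (\dim (H1 + H2)) (\dim (H1 :&: H2)) => [|[|[|[|a]]]] [|[|b]].
Qed.

Lemma point_eq p q : \dim p = 1%N -> \dim q = 1%N -> (p <= q)%VS -> p = q.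
Proof. by move=> d1 d2 le; apply/eqP; rewrite eqEdim le d1 d2. Qed.

Lemma meet_intersection_point A H1 H2 : H1 \in A -> H2 \in A -> H1 != H2 ->
  (H1 :&: H2)%VS \in intersection_points A.
Proof.
move=> H1A H2A neq; apply/imfsetP; exists (H1, H2) => //=.
by rewrite !inE /= H1A H2A neq.
Qed.

Lemma not_concurrent_line A p :
  essential A -> \dim p = 1%N -> exists2 H, H \in A & ~~ (p <= H)%VS.
Proof.
move=> essA dp.
have [/hasP[H HA pH]|/hasPn noH] := boolP (has (fun H => ~~ (p <= H)%VS) A).
  by exists H.
by case: essA; exists p; split=> // H HA; have /negPn := noH H HA.
Qed.

Section GenericLine.

Variables (A : {fset subspace3 K}) (p L : subspace3 K).
Hypothesis data : generic_extension_data A p L.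

Lemma generic_dims : [/\ \dim p = 1%N, \dim L = 2%N & {in A, forall H, \dim H = 2%N}].
Proof.
case: data => arrA _ [+ _] [dL _ _ _].
by rewrite in_intersection_points // => /andP[/eqP dp _].
Qed.

Lemma generic_neq H : H \in A -> L != H.
Proof. by move=> HA; case: data => _ _ _ [_ + _ _]; apply: contraNneq => ->. Qed.

Lemma generic_meet_dim H : H \in A -> \dim (L :&: H)%VS = 1%N.
Proof.
move=> HA; have [_ dL dA] := generic_dims.
by apply: dim_meet => //; [apply: dA|apply: generic_neq].
Qed.

Lemma generic_meet_center H : H \in A -> (p <= H)%VS -> (L :&: H)%VS = p.
Proof.
move=> HA pH; have [dp dL dA] := generic_dims.
apply/esym/point_eq; rewrite ?generic_meet_dim //.
by case: data => _ _ _ [_ _ pL _]; rewrite subv_cap pL.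
Qed.

(** Distinct lines of A through a common point of L meet at an intersection point
    of A lying on L, and p is the only one. *)
Lemma generic_meet_shared H1 H2 : H1 \in A -> H2 \in A -> H1 != H2 ->
  (L :&: H1 <= H2)%VS -> (p <= H1)%VS /\ (p <= H2)%VS.
Proof.
move=> H1A H2A neq le; have [dp dL dA] := generic_dims.
have e : (L :&: H1)%VS = (H1 :&: H2)%VS.
  apply: point_eq; first exact: generic_meet_dim.
    by apply: dim_meet => //; apply: dA.
  by rewrite subv_cap capvSr le.
case: data => _ _ _ [_ _ _ /(_ _ (meet_intersection_point H1A H2A neq))].
by rewrite -e capvSl => /(_ isT) <-; rewrite e capvSl capvSr.
Qed.

End GenericLine.

End PlaneGeometry.

Section LineRestriction.

Variables (K : fieldType) (charK : [pchar K] =i pred0).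
Implicit Types (Q : {mpoly K[3]}) (v w x : 'rV[K]_3).

Lemma meval_homogZ Q e a x : Q \is e.-homog ->
  Q.@[(a *: x) ord0] = a ^+ e * Q.@[x ord0].
Proof.
move=> hQ; rewrite !mevalE mulr_sumr big_seq [RHS]big_seq.
apply: eq_bigr => m /(dhomog_mf hQ) <-; rewrite /= mulrCA; congr (_ * _).
under eq_bigr => i _ do rewrite mxE exprMn.
by rewrite big_split /= mdegE expr_sum.
Qed.

(** The parametrization of the line through v and w misses only the point w. *)
Lemma line_polynomial Q e v w : Q \is e.-homog ->
  exists2 q : {poly K}, (size q <= e.+1)%N &
    forall t, q.[t] = Q.@[(v + t *: w) ord0].
Proof.
move=> hQ; pose a i : {poly K} := (v ord0 i)%:P + w ord0 i *: 'X.
exists (\sum_(m <- msupp Q) Q@_m *: \prod_(i < 3) a i ^+ m i) => [|t].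
  rewrite big_seq; apply: (leq_trans (size_sum _ _ _)); apply/bigmax_leqP_seq.
  move=> m _ mQ; rewrite -(dhomog_mf hQ mQ) /= mdegE.
  apply: (leq_trans (size_scale_leq _ _)).
  elim/big_rec2: _ => [|i d u _ IH]; first by rewrite size_poly1.
  have sa : (size (a i ^+ m i) <= (m i).+1)%N.
    apply: (leq_trans (size_exp_leq _ _)); rewrite ltnS -[X in (_ <= X)%N]mul1n.
    rewrite leq_mul2r -subn1 leq_subLR addn1 orbC.
    apply/orP; left; apply: (leq_trans (size_polyD _ _)); rewrite geq_max.
    rewrite (leq_trans (size_polyC_leq1 _)) //=.
    by rewrite (leq_trans (size_scale_leq _ _)) ?size_polyX.
  apply: (leq_trans (size_polyMleq _ _)).
  by move: sa IH; case: (size _) (size u) => [|x] [|y]; rewrite ?addn0 ?addnS //=; lia.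
rewrite horner_sum mevalE; apply: eq_bigr => m _.
rewrite hornerZ horner_prod; congr (_ * _); apply: eq_bigr => i _.
by rewrite horner_exp /a !hornerE !mxE mulrC.
Qed.

(** The parameter t stands for the point v + t w, so w itself is at infinity;
    the values there follow from those at b w + t v for t != 0. *)
Lemma vanishing_on_line Q e v w (ts : seq K) : Q \is e.-homog ->
  uniq ts -> (e < size ts)%N -> {in ts, forall t, Q.@[(v + t *: w) ord0] = 0} ->
  forall x, x \in (<[v]> + <[w]>)%VS -> Q.@[x ord0] = 0.
Proof.
move=> hQ uts lt_e Q0.
have {lt_e Q0} Q0 t : Q.@[(v + t *: w) ord0] = 0.
  have [q sq qE] := line_polynomial v w hQ.
  rewrite -qE (_ : q = 0) ?horner0 //.
  apply: (@roots_geq_poly_eq0 _ q ts) => //; last exact: leq_trans sq lt_e.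
  by apply/allP => s sts; rewrite /root qE Q0.
have {}Q0 a b : a != 0 -> Q.@[(a *: v + b *: w) ord0] = 0.
  move=> a0; rewrite (_ : a *: v + b *: w = a *: (v + (b / a) *: w)).
    by rewrite (meval_homogZ _ _ hQ) Q0 mulr0.
  by rewrite scalerDr scalerA mulrCA divff // mulr1.
move=> x /memv_addP[_ /vlineP[a ->] [_ /vlineP[b ->] ->]].
(* x = b w is reached as the value at t = 0 of a polynomial in t vanishing for
   all other t. *)
have [->|] := eqVneq a 0; last exact: Q0.
have [q _ qE] := line_polynomial (b *: w) v hQ.
have qX : 'X * q = 0.
  apply: poly_fun_eq0 => // t; rewrite hornerM hornerX qE addrC.
  by have [->|t0] := eqVneq t 0; rewrite ?mul0r // Q0 ?mulr0.
have := qE 0; rewrite addrC => <-; move/eqP: qX.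
by rewrite mulf_eq0 polyX_eq0 /= => /eqP ->; rewrite horner0.
Qed.

End LineRestriction.

(** * Syzygies tangent to the generic line *)

Lemma card_fset_count (T : choiceType) (A : {fset T}) (P : pred T) :
  #|` [fset x in A | P x]%fset| = count P A.
Proof.
rewrite -size_filter; apply/perm_size/uniq_perm => [||x] //.
  by rewrite filter_uniq.
by rewrite !inE mem_filter andbC.
Qed.

Lemma multiplicityE (K : fieldType) (A : {fset subspace3 K}) (p : subspace3 K) :
  multiplicity A p = count (fun H => p <= H)%VS A.
Proof. exact: card_fset_count. Qed.

Lemma count_avoiding (K : fieldType) (A : {fset subspace3 K}) (p : subspace3 K) :
  count (fun H => ~~ (p <= H)%VS) A = (#|` A| - multiplicity A p)%N.
Proof.
by rewrite multiplicityE -(count_predC (fun H => p <= H)%VS A) addKn.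
Qed.

Section Arrangement.

Variables (K : fieldType) (charK : [pchar K] =i pred0).
Implicit Types (A : {fset subspace3 K}) (H p L : subspace3 K).
Implicit Types (g : 'I_3 -> {mpoly K[3]}) (u v w x : 'rV[K]_3).

Lemma point_generator p : \dim p = 1%N -> exists2 v, v != 0 & p = <[v]>%VS.
Proof.
move=> dp; exists (vpick p); first by rewrite vpick0 -dimv_eq0 dp.
have v0 : vpick p != 0 by rewrite vpick0 -dimv_eq0 dp.
by apply/esym/eqP; rewrite eqEdim dim_vline v0 dp -memvE memv_pick.
Qed.

Lemma meval_form_comb (l : {mpoly K[3]}) v w t : l \is 1.-homog ->
  l.@[(v + t *: w) ord0] = l.@[v ord0] + t * l.@[w ord0].
Proof.
move=> hl; rewrite !(meval_linear_form _ hl) mulr_sumr -big_split /=.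
by apply: eq_bigr => i _; rewrite !mxE; ring.
Qed.

(** At a point x with l(x) = 0, the value of g(l) is l evaluated at the vector
    g(x). *)
Lemma tangent_value (l : {mpoly K[3]}) H g x :
  cuts_out l H -> multiple l (derivation g l) -> x \in H ->
  \row_i (g i).@[x ord0] \in H.
Proof.
move=> [hl lH] [h gl]; rewrite !lH => /eqP lx0; apply/eqP.
have := congr1 (meval (x ord0)) gl.
rewrite mevalM lx0 mul0r => <-; rewrite (meval_linear_form _ hl) /derivation.
rewrite raddf_sum; apply: eq_bigr => i _ /=.
by rewrite mevalM (mderiv_linear_form _ hl) mevalC mxE mulrC.
Qed.

(** A field tangent to both lines is, at their common point x, proportional to x
    itself; the expressions below are the 2 x 2 minors of the matrix (g, x). *)
Lemma minor_vanishes (l1 l2 : {mpoly K[3]}) H1 H2 g x i j :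
  cuts_out l1 H1 -> cuts_out l2 H2 -> \dim (H1 :&: H2)%VS = 1%N ->
  multiple l1 (derivation g l1) -> multiple l2 (derivation g l2) ->
  x \in (H1 :&: H2)%VS ->
  (g i * 'X_j - g j * 'X_i).@[x ord0] = 0.
Proof.
move=> c1 c2 d12 m1 m2 xH; rewrite mevalB !mevalM !mevalXU.
have [->|x0] := eqVneq x 0; first by rewrite !mxE !mulr0 subrr.
have e : <[x]>%VS = (H1 :&: H2)%VS.
  by apply: point_eq; rewrite ?dim_vline ?x0 // -memvE.
have /vlineP[c yE] : \row_i (g i).@[x ord0] \in <[x]>%VS.
  move: xH; rewrite e !memv_cap => /andP[xH1 xH2].
  by rewrite (tangent_value c1) // (tangent_value c2).
have gE k : (g k).@[x ord0] = c * x ord0 k.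
  by have := congr1 (fun y : 'rV_3 => y ord0 k) yE; rewrite !mxE.
by rewrite !gE; ring.
Qed.

Lemma generic_form_not_multiple A p L l l0 :
  generic_extension_data A p L -> {in A, forall H, cuts_out (l H) H} ->
  cuts_out l0 L -> ~ multiple l0 (\prod_(H <- A) l H).
Proof.
move=> data cA cL; have [_ dL dA] := generic_dims data.
move/(multiple_prod_forms charK dL cL dA cA).
by case: data => _ _ _ [_ /negPf -> _ _].
Qed.

(** Otherwise the product of the forms would vanish on L, hence be divisible by l0. *)
Lemma generic_line_witness A p L l :
  generic_extension_data A p L -> {in A, forall H, cuts_out (l H) H} ->
  forall l0, cuts_out l0 L ->
  exists2 w, w \in L & {in A, forall H, (l H).@[w ord0] != 0}.
Proof.
move=> data cA l0 cL; have [dp dL dA] := generic_dims data.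
apply: NNPP => noW.
have : multiple l0 (\prod_(H <- A) l H).
  apply/(multiple_cut_out charK _ dL cL) => v vL; apply: NNPP => fv0; apply: noW.
  exists v => // H HA; apply/negP => /eqP lv0; apply: fv0.
  by rewrite rmorph_prod /= (bigD1_seq H) //= lv0 mul0r.
exact: (generic_form_not_multiple data cA cL).
Qed.

(** The line L meets A in d' - m' + 1 distinct points: p, and one point for each
    line of A avoiding p. There the minors g_i X_j - g_j X_i, of degree r + 1,
    vanish; if r < d' - m' they vanish on L and are divisible by l0. Contracting
    with the partial derivatives of f, which g kills, Euler's formula gives
    l0 | d' g_j f, whence l0 | g_j. *)
Lemma tangent_syzygy_multiple A p L l l0 g r :
  generic_extension_data A p L -> {in A, forall H, cuts_out (l H) H} ->
  cuts_out l0 L -> (forall i, g i \is r.-homog) ->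
  derivation g (\prod_(H <- A) l H) = 0 -> multiple l0 (derivation g l0) ->
  (r < #|` A| - multiplicity A p)%N -> forall j, multiple l0 (g j).
Proof.
move=> data cA cL hg gf gl0 ltr; have [dp dL dA] := generic_dims data.
have [w wL lw] := generic_line_witness data cA cL.
have [v v0 pE] := point_generator dp.
have pL : (p <= L)%VS by case: data => _ _ _ [].
have vL : v \in L by rewrite memvE -pE.
have w_notin : w \notin <[v]>%VS.
  have [H HA] : exists2 H, H \in A & (p <= H)%VS.
    case: (data) => arrA _ [+ _] _; rewrite in_intersection_points //.
    rewrite multiplicityE => /andP[_ /ltnW]; rewrite -has_count => /hasP[H].
    by exists H.
  rewrite pE => vH; apply/negP => /(subvP vH); rewrite (cA _ HA).2.
  by rewrite (negPf (lw _ HA)).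
have LE : (<[v]> + <[w]>)%VS = L.
  apply/eqP; rewrite eqEdim subv_add -!memvE vL wL /= dL.
  have : (<[v]> :&: <[w]>)%VS = 0%VS.
    apply/eqP; rewrite -subv0; apply/subvP => x; rewrite memv_cap.
    case/andP=> xv /vlineP[c xE]; have [c0|c0] := eqVneq c 0.
      by rewrite xE c0 scale0r mem0v.
    case/negP: w_notin; rewrite (_ : w = c^-1 *: x); first exact: memvZ.
    by rewrite xE scalerA mulVf // scale1r.
  have w0 : w != 0 by apply: contraNneq w_notin => ->; rewrite mem0v.
  by move/eqP; rewrite -dimv_eq0 => /eqP d0; have := dimv_sum_cap <[v]> <[w]>;
    rewrite d0 addn0 !dim_vline v0 w0 => ->.
(* u H is the point where H meets L; the choice of w keeps w off every H, so
   that no such point is at infinity. The centre p corresponds to t = 0. *)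
pose t H := - (l H).@[v ord0] / (l H).@[w ord0].
pose u H := v + t H *: w.
have uL H : u H \in L by rewrite memvD // memvZ.
have uH H : H \in A -> u H \in H.
  move=> HA; rewrite (cA _ HA).2 (meval_form_comb _ _ _ (cA _ HA).1).
  by rewrite divfK ?lw // subrr.
have u0 H : u H != 0.
  apply: contraNneq w_notin => e; have [t0|t0] := eqVneq (t H) 0.
    by move: e v0; rewrite /u t0 scale0r addr0 => ->; rewrite eqxx.
  rewrite (_ : w = - (t H)^-1 *: v); first by rewrite memvZ ?memv_line.
  apply: (scalerI t0); rewrite scalerA mulrN mulfV // scaleN1r.
  by apply/eqP; rewrite -addr_eq0 addrC; apply/eqP.
have center H : H \in A -> (p <= H)%VS = (t H == 0).
  move=> HA; rewrite pE -memvE (cA _ HA).2.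
  by rewrite mulf_eq0 oppr_eq0 invr_eq0 (negPf (lw _ HA)) orbF.
pose ts := 0 :: [seq t H | H <- A & ~~ (p <= H)%VS].
have uts : uniq ts.
  rewrite cons_uniq; apply/andP; split.
    apply/mapP => -[H]; rewrite mem_filter => /andP[pH HA] /esym/eqP.
    by rewrite -center // (negPf pH).
  rewrite map_inj_in_uniq ?filter_uniq ?fset_uniq // => H1 H2.
  rewrite !mem_filter => /andP[pH1 H1A] /andP[pH2 H2A] et.
  apply/eqP; apply: contraNT pH1 => neq.
  suff /(generic_meet_shared data H1A H2A neq)[] : (L :&: H1 <= H2)%VS by [].
  have <- : <[u H1]>%VS = (L :&: H1)%VS.
    apply: point_eq; rewrite ?(generic_meet_dim data) ?dim_vline ?u0 //.
    by rewrite -memvE memv_cap uL uH.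
  by rewrite -memvE /u et uH.
have hts : (r.+1 < size ts)%N by rewrite /= size_map size_filter count_avoiding.
have minor i j : multiple l0 (g i * 'X_j - g j * 'X_i).
  apply/(multiple_cut_out charK _ dL cL); rewrite -LE.
  have hQ : g i * 'X_j - g j * 'X_i \is r.+1.-homog.
    have gX a b : g a * 'X_b \is r.+1.-homog.
      by rewrite -[r.+1]addn1; apply: dhomogM => //; rewrite dhomogX /= mdeg1.
    by rewrite rpredB.
  apply: (vanishing_on_line charK hQ uts hts) => s.
  have vanish H : H \in A -> (g i * 'X_j - g j * 'X_i).@[u H ord0] = 0.
    move=> HA; apply: (minor_vanishes _ _ cL (cA _ HA)) => //.
    - exact: (generic_meet_dim data).
    - exact: (logarithmic charK (fset_uniq A) dA cA gf HA).
    - by rewrite memv_cap uL uH.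
  rewrite in_cons => /orP[/eqP ->|/mapP[H + ->]]; last first.
    by rewrite mem_filter => /andP[_ HA]; apply: vanish.
  case: (data) => arrA _ [+ _] _; rewrite in_intersection_points //.
  rewrite multiplicityE => /andP[_ /ltnW]; rewrite -has_count => /hasP[H HA pH].
  by have := vanish H HA; rewrite /u; move: pH; rewrite center // => /eqP ->.
move=> j; pose f := \prod_(H <- A) l H.
have hf : f \is #|` A|.-homog by exact: prod_arrangement_homog.
have : multiple l0 (g j * (f *+ #|` A|)).
  have {}minor i : exists h, g i * 'X_j - g j * 'X_i = l0 * h by exact: minor.
  have [h hE] := fin_all_exists minor.
  exists (- (derivation h f)); rewrite -(euler_homog hf) /derivation.
  have : 'X_j * derivation g f = 0 by rewrite gf mulr0.
  rewrite /derivation mulrN !mulr_sumr => e0; apply/eqP.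
  rewrite -addr_eq0 -[X in _ == X]e0 -big_split; apply/eqP.
  apply: eq_bigr => i _ /=; rewrite [l0 * _]mulrA -hE; ring.
case/(multiple_prime cL.1 (cuts_out_neq0 dL cL)) => //.
rewrite -scaler_nat -mul_mpolyC.
case/(multiple_prime cL.1 (cuts_out_neq0 dL cL)).
  move/(multiple_cut_out charK _ dL cL)/(_ 0); rewrite mem0v mevalC => /(_ isT)/eqP.
  by rewrite natr_eq0_char0 // => /eqP e; move: ltr; rewrite e.
by move/(generic_form_not_multiple data cA cL).
Qed.

End Arrangement.

(** * Minimal degrees of syzygies *)

Section SyzygyDegrees.

Variables (K : fieldType) (charK : [pchar K] =i pred0).
Implicit Types (A : {fset subspace3 K}) (p L : subspace3 K) (f : {mpoly K[3]}).

Lemma derivation_prod_eq0 (g : 'I_3 -> {mpoly K[3]}) (I : Type) (s : seq I)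
    (P : pred I) (F : I -> {mpoly K[3]}) :
  (forall i, P i -> derivation g (F i) = 0) ->
  derivation g (\prod_(i <- s | P i) F i) = 0.
Proof.
move=> F0; elim/big_rec: _ => [|i f Pi IH].
  by rewrite /derivation big1 // => i _; rewrite -mpolyC1 mderivC mulr0.
by rewrite derivationM F0 // IH mul0r mulr0 addr0.
Qed.

(** With v a vector of p and f2 the product of the forms of the lines avoiding p,
    the derivative along v kills the forms of the other lines. Hence f2 times this
    derivative multiplies f by the derivative of f2 along v, which a multiple of
    the Euler field corrects. The degree is that of f2. *)
Lemma central_syzygy A p l :
  {in A, forall H, \dim H = 2%N} -> {in A, forall H, cuts_out (l H) H} ->
  \dim p = 1%N -> (0 < #|` A| - multiplicity A p)%N ->
  has_syzygy (\prod_(H <- A) l H) (#|` A| - multiplicity A p).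
Proof.
move=> dA cA dp; rewrite -count_avoiding => e_gt0.
have [v v0 pE] := point_generator dp.
set e := count _ _ in e_gt0 *.
pose f1 := \prod_(H <- A | (p <= H)%VS) l H.
pose f2 := \prod_(H <- A | ~~ (p <= H)%VS) l H.
have fE : \prod_(H <- A) l H = f1 * f2 by rewrite (bigID (fun H => p <= H)%VS).
have hA : {in A, forall H, l H \is 1.-homog} by move=> H /cA[].
have hf2 : f2 \is e.-homog by exact: prod_forms_homog.
have f20 : f2 != 0 by exact: prod_forms_neq0.
have hf : f1 * f2 \is #|` A|.-homog by rewrite -fE; apply: prod_arrangement_homog.
have d_gt0 : (0 < #|` A|)%N by apply: leq_trans e_gt0 (count_size _ _).
pose c : {mpoly K[3]} := (#|` A|%:R^-1 : K)%:MP.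
have cd : c *+ #|` A| = 1.
  rewrite /c -mpolyCMn -(mulr_natr _^-1) mulVf //.
  by rewrite natr_eq0_char0 // -lt0n.
pose D : 'I_3 -> {mpoly K[3]} := fun i => (v ord0 i)%:MP.
have Df1 : derivation D f1 = 0.
  rewrite /f1 big_seq_cond; apply: derivation_prod_eq0 => H /andP[HA].
  rewrite pE -memvE (cA _ HA).2 => /eqP lv0.
  transitivity ((l H).@[v ord0])%:MP_[3]; last by rewrite lv0.
  rewrite (meval_linear_form _ (hA _ HA)) raddf_sum; apply: eq_bigr => i _ /=.
  by rewrite (mderiv_linear_form _ (hA _ HA)) mpolyCM mulrC.
pose g i := f2 * D i + - (c * derivation D f2) * 'X_i.
exists g; split.
- move=> i; rewrite /g mulNr mulrC mul_mpolyC -mulrA [c * _]mul_mpolyC.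
  rewrite rpredB ?dhomogZ // -(prednK e_gt0) -[e.-1.+1]addn1.
  apply: dhomogM; last by rewrite dhomogX /= mdeg1.
  apply: rpred_sum => k _; rewrite mul_mpolyC dhomogZ //.
  exact: mderiv_homog.
(* If g = 0, then the constant vector v is proportional to (X, Y, Z). *)
- apply: (@exists_neq0 _ g) => g0.
  have gE i : f2 * D i = c * derivation D f2 * 'X_i.
    by have /eqP := g0 i; rewrite /g mulNr subr_eq0 => /eqP.
  have prop i j : D i * 'X_j = D j * 'X_i.
    by apply: (mulfI f20); rewrite !mulrA !gE; ring.
  case/eqP: v0; apply/rowP => i; rewrite mxE.
  have [j neq] : exists j : 'I_3, j != i.
    by exists (lift i ord0); rewrite eq_sym neq_lift.
  have := congr1 (mcoeff U_(j)%MM) (prop i j).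
  by rewrite !mcoeffCM !mcoeffXU eqxx eq_sym (negPf neq) mulr0 mulr1.
- rewrite -[LHS]/(derivation g _) fE derivation_comb (euler_homog hf).
  rewrite derivationM Df1.
  have -> : - (c * derivation D f2) * ((f1 * f2) *+ #|` A|) =
     - (c *+ #|` A|) * (derivation D f2 * (f1 * f2)) by ring.
  by rewrite cd; ring.
Qed.

Lemma defining_polynomialP A f : line_arrangement A -> defining_polynomial A f ->
  exists2 l, {in A, forall H, cuts_out (l H) H} & f = \prod_(H <- A) l H.
Proof.
by move=> arrA [l [hl cl ->]]; exists l => // H HA; split=> [|v]; [exact: hl|exact: cl].
Qed.

(** Two defining polynomials of one arrangement are proportional, hence have the
    same syzygies. *)
Lemma prod_forms_unique (s : seq (subspace3 K)) (l1 l2 : subspace3 K -> {mpoly K[3]}) :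
  {in s, forall H, \dim H = 2%N} -> {in s, forall H, cuts_out (l1 H) H} ->
  {in s, forall H, cuts_out (l2 H) H} ->
  exists2 c : K, c != 0 & \prod_(H <- s) l2 H = c *: \prod_(H <- s) l1 H.
Proof.
elim: s => [|H s IHs] dA c1 c2.
  by exists 1; rewrite ?oner_eq0 // !big_nil scale1r.
have Hs : H \in H :: s by rewrite mem_head.
have [a a0 ea] := cuts_out_unique charK (dA _ Hs) (c1 _ Hs) (c2 _ Hs).
have [|||b b0 eb] := IHs.
- by move=> G Gs; apply: dA; rewrite in_cons Gs orbT.
- by move=> G Gs; apply: c1; rewrite in_cons Gs orbT.
- by move=> G Gs; apply: c2; rewrite in_cons Gs orbT.
exists (a * b); first by rewrite mulf_neq0.
by rewrite !big_cons ea eb -scalerAl -scalerAr scalerA.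
Qed.

Lemma has_syzygyZ c f r : c != 0 -> has_syzygy (c *: f) r <-> has_syzygy f r.
Proof.
move=> c0; split=> -[g [hg g0 gf]]; exists g; split=> //; last first.
  by rewrite -[LHS]/(derivation g _) derivationZr [derivation _ _]gf scaler0.
move/eqP: gf; rewrite -[X in X == 0]/(derivation g _) derivationZr.
by rewrite scaler_eq0 (negPf c0) => /eqP.
Qed.

Variables (A : {fset subspace3 K}) (p L : subspace3 K) (f' f : {mpoly K[3]}).
Hypotheses (data : generic_extension_data A p L).
Hypotheses (hf' : defining_polynomial A f')
           (hf : defining_polynomial (L |` A)%fset f).

Lemma arrangement_extension : line_arrangement (L |` A)%fset.
Proof.
have [_ dL dA] := generic_dims data.
by move=> H /fset1UP[->|/dA].
Qed.

(** The forms of f along A define A too, so f' may be replaced by the cofactor of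
    the form of L in f. *)
Lemma extension_forms : exists l0 l,
  [/\ cuts_out l0 L, {in A, forall H, cuts_out (l H) H},
      f = l0 * \prod_(H <- A) l H
    & forall r, has_syzygy f' r <-> has_syzygy (\prod_(H <- A) l H) r].
Proof.
have [_ dL dA] := generic_dims data.
have [l cl fE] := defining_polynomialP arrangement_extension hf.
have [l' cl' f'E] := defining_polynomialP dA hf'.
have clA : {in A, forall H, cuts_out (l H) H}.
  by move=> H HA; apply: cl; rewrite fset1Ur.
have [c c0 e] := prod_forms_unique dA cl' clA.
exists (l L), l; split=> //; first by apply: cl; rewrite fset1U1.
  rewrite fE big_fsetU1 //.
  by case: data => _ _ _ [].
by move=> r; rewrite e f'E has_syzygyZ.
Qed.

Lemma avoiding_gt0 : (0 < #|` A| - multiplicity A p)%N.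
Proof.
have [dp _ _] := generic_dims data.
have [H HA pH] : exists2 H, H \in A & ~~ (p <= H)%VS.
  by apply: not_concurrent_line dp; case: data.
by rewrite -count_avoiding -has_count; apply/hasP; exists H.
Qed.

Lemma multiplicity_extension q :
  multiplicity (L |` A)%fset q = ((q <= L)%VS + multiplicity A q)%N.
Proof.
have LA : L \notin A by case: data => _ _ _ [].
rewrite !multiplicityE -![count _ (enum_fset _)]sum1_count.
by rewrite big_mkcond big_fsetU1 //= [in RHS]big_mkcond; case: (_ <= L)%VS.
Qed.

Variables (r' r : nat).
Hypotheses (hr' : minimal_syzygy_degree f' r') (hr : minimal_syzygy_degree f r).

Lemma minimal_degree_bounds : (r' <= r <= r'.+1)%N.
Proof.
have [_ dL dA] := generic_dims data.
have [l0 [l [c0 cA fE eqf']]] := extension_forms.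
have hF : \prod_(H <- A) l H \is #|` A|.-1.+1.-homog.
  rewrite prednK; last by apply: leq_trans avoiding_gt0 (leq_subr _ _).
  exact: prod_arrangement_homog.
have F0 : \prod_(H <- A) l H != 0 by exact: prod_forms_neq0.
have l00 := cuts_out_neq0 dL c0.
have ndvd := generic_form_not_multiple charK data cA c0.
apply/andP; split.
  apply: hr'.2; apply/eqf'; have := hr.1; rewrite fE.
  by case/(syzygy_deletion charK c0.1 l00 hF ndvd) => g [hg g0 gf _]; exists g.
apply: hr.2; rewrite fE; apply: (syzygy_addition charK c0.1 l00 hF F0).
by apply/eqf'; exact: hr'.1.
Qed.

(** If r = r', deletion turns a minimal syzygy of f into a syzygy of f' of degree r'
    tangent to L; it is then divisible by the form of L, and its quotient has
    degree r' - 1. *)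
Lemma minimal_degree_increases : (r' < #|` A| - multiplicity A p)%N -> r != r'.
Proof.
move=> ltr; apply/eqP => er; have [_ dL dA] := generic_dims data.
have [l0 [l [c0 cA fE eqf']]] := extension_forms.
have hF : \prod_(H <- A) l H \is #|` A|.-1.+1.-homog.
  rewrite prednK; last by apply: leq_trans avoiding_gt0 (leq_subr _ _).
  exact: prod_arrangement_homog.
have l00 := cuts_out_neq0 dL c0.
have ndvd := generic_form_not_multiple charK data cA c0.
have := hr.1; rewrite fE er.
case/(syzygy_deletion charK c0.1 l00 hF ndvd) => g [hg [k gk] gf gl0].
have mul i : exists h, g i = l0 * h.
  exact: (tangent_syzygy_multiple charK data cA c0 hg gf gl0 ltr).
have [h hE] := fin_all_exists mul.
have h0 i : g i != 0 -> h i != 0.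
  by apply: contraNneq => e; rewrite hE e mulr0.
have r'_gt0 : (0 < r')%N.
  rewrite lt0n; apply: contraNneq (h0 _ gk) => r0; apply/eqP.
  by have := hg k; rewrite hE r0 => hh; apply: (quotient_eq0 charK l00 c0.1 hh).
suff /hr'.2 : has_syzygy f' r'.-1 by rewrite -ltnS prednK // ltnn.
apply/eqf'; exists h; split.
- move=> i; have := hg i; rewrite hE => /(quotient_homog charK l00 c0.1).
  by rewrite subn1.
- by exists k; apply: h0.
- apply: (mulfI l00); rewrite mulr0 -[RHS]gf /derivation mulr_sumr.
  by apply: eq_bigr => i _; rewrite hE mulrA.
Qed.

(** The point p has multiplicity m' + 1 on the d' + 1 lines of the extension. *)
Lemma minimal_degree_le_avoiding : (r <= #|` A| - multiplicity A p)%N.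
Proof.
have [dp dL dA] := generic_dims data.
have pL : (p <= L)%VS by case: data => _ _ _ [].
have LA : L \notin A by case: data => _ _ _ [].
have [l cl fE] := defining_polynomialP arrangement_extension hf.
have e : (#|` (L |` A)%fset| - multiplicity (L |` A)%fset p)%N =
         (#|` A| - multiplicity A p)%N.
  by rewrite multiplicity_extension pL cardfsU1 LA subnDl.
apply: hr.2; rewrite fE -e; apply: central_syzygy => //.
  exact: arrangement_extension.
by rewrite e avoiding_gt0.
Qed.

End SyzygyDegrees.

(** * Weak combinatorics *)

Section WeakCombinatorics.

Variable K : fieldType.
Implicit Types (A B : {fset subspace3 K}) (H p q L : subspace3 K).
Local Open Scope nat_scope.

(** Every invariant of the weak combinatorics used below is such a sum: n_j, the
    Tjurina number, and the number of pairs of lines. *)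
Definition point_sum A (F : nat -> nat) :=
  \sum_(q <- intersection_points A) F (multiplicity A q).

Lemma multiplicity_le_card A q : multiplicity A q <= #|` A|.
Proof. by rewrite multiplicityE count_size. Qed.

Lemma npoints_point_sum A j : npoints A j = point_sum A (fun m => m == j).
Proof. by rewrite /npoints card_fset_count -sum1_count big_mkcond. Qed.

Lemma point_sum_npoints A F N : line_arrangement A -> #|` A| < N ->
  point_sum A F = \sum_(2 <= j < N) npoints A j * F j.
Proof.
move=> arrA ltN; under eq_bigr => j _ do rewrite npoints_point_sum big_distrl.
rewrite exchange_big /= /point_sum big_seq [RHS]big_seq; apply: eq_bigr => q.
rewrite in_intersection_points // => /andP[_ m_gt1].
have m_in : multiplicity A q \in index_iota 2 N.
  by rewrite mem_index_iota m_gt1 (leq_ltn_trans (multiplicity_le_card _ _)).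
rewrite (bigD1_seq _ m_in) ?iota_uniq //= eqxx mul1n big1 ?addn0 // => j /negPf.
by rewrite eq_sym => ->.
Qed.

Lemma same_weak_point_sum A B F : line_arrangement A -> line_arrangement B ->
  same_weak_combinatorics A B -> point_sum A F = point_sum B F.
Proof.
move=> arrA arrB AB; pose N := (#|` A| + #|` B|).+1.
rewrite (@point_sum_npoints A F N) ?(@point_sum_npoints B F N) //; last 2 first.
- by rewrite ltnS leq_addl.
- by rewrite ltnS leq_addr.
rewrite big_seq [RHS]big_seq; apply: eq_bigr => j.
by rewrite mem_index_iota => /andP[j_gt1 _]; rewrite AB.
Qed.

(** Two distinct lines meet in exactly one intersection point. *)
Lemma point_sum_pairs A : line_arrangement A ->
  point_sum A (fun m => m * m.-1) = #|` A| * (#|` A|).-1.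
Proof.
move=> arrA.
have pairs (s : seq (subspace3 K)) : uniq s ->
    \sum_(H1 <- s) \sum_(H2 <- s | H2 != H1) 1 = size s * (size s).-1.
  move=> us; rewrite big_seq (eq_bigr (fun=> (size s).-1)) => [|H1 H1s].
    by rewrite -big_seq big_const_seq count_predT iter_addn_0 mulnC.
  rewrite sum1_count -(count_predC (pred1 H1) s) count_uniq_mem // H1s.
  by rewrite add1n.
rewrite -(pairs A) ?fset_uniq //.
transitivity (\sum_(q <- intersection_points A)
   \sum_(H1 <- A) \sum_(H2 <- A | H2 != H1) ((q <= H1)%VS && (q <= H2)%VS : nat)).
  apply: eq_bigr => q _; rewrite multiplicityE -size_filter.
  rewrite -pairs ?filter_uniq ?fset_uniq //.
  rewrite big_filter big_mkcond; apply: eq_bigr => H1 _.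
  case: (q <= H1)%VS => /=; last by rewrite big1.
  by rewrite big_filter_cond [RHS]big_mkcond [LHS]big_mkcond; apply: eq_bigr => H2 _;
     case: (q <= H2)%VS; case: (_ != _).
rewrite exchange_big /= big_seq [RHS]big_seq; apply: eq_bigr => H1 H1A.
rewrite exchange_big big_seq_cond [RHS]big_seq_cond.
apply: eq_bigr => H2 /andP[H2A neq].
have mI : (H1 :&: H2)%VS \in intersection_points A.
  by apply: meet_intersection_point; rewrite // eq_sym.
rewrite (bigD1_seq _ mI) ?fset_uniq //= capvSl capvSr big_seq_cond big1 ?addn0 //.
move=> q /andP[]; rewrite in_intersection_points // => /andP[/eqP dq _].
rewrite -subv_cap => neqq; apply/eqP; rewrite eqb0; apply: contraNN neqq => le.
apply/eqP/point_eq => //; apply: dim_meet; rewrite ?arrA //.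
by rewrite eq_sym.
Qed.

Section Extension.

Variables (A : {fset subspace3 K}) (p L : subspace3 K).
Hypothesis data : generic_extension_data A p L.

Lemma multiplicity_new_point H : H \in A -> ~~ (p <= H)%VS ->
  multiplicity A (L :&: H)%VS = 1.
Proof.
move=> HA pH; rewrite multiplicityE.
rewrite (@eq_in_count _ _ (pred1 H)) => [|H' H'A /=].
  by rewrite count_uniq_mem ?fset_uniq ?HA.
apply/idP/eqP => [le|->]; last exact: capvSr.
apply/eqP; apply: contraNT pH; rewrite eq_sym => neq.
by have [] := generic_meet_shared data HA H'A neq le.
Qed.

(** Each line of A avoiding p meets L in a new double point, and these points are
    distinct; the lines of A through p meet L at p. *)
Lemma extension_intersection_points :
  perm_eq (intersection_points (L |` A)%fset)
    (intersection_points A ++ [seq (L :&: H)%VS | H <- A & ~~ (p <= H)%VS]).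
Proof.
have [dp dL dA] := generic_dims data; case: (data) => _ _ [ptsp _] [_ LA pL gen].
apply: uniq_perm => [||q]; first exact: fset_uniq.
  rewrite cat_uniq fset_uniq /=; apply/andP; split.
    apply/hasPn => q /mapP[H]; rewrite mem_filter => /andP[pH HA] ->.
    apply: contraNN pH => /gen/(_ (capvSl _ _)) <-; exact: capvSr.
  rewrite map_inj_in_uniq ?filter_uniq ?fset_uniq // => H1 H2.
  rewrite !mem_filter => /andP[pH1 H1A] /andP[pH2 H2A] e.
  apply/eqP; apply: contraNT pH1 => neq.
  by have [] := generic_meet_shared data H1A H2A neq; rewrite ?e ?capvSr.
rewrite mem_cat (in_intersection_points _ (arrangement_extension data)).
rewrite (multiplicity_extension data).
apply/andP/orP => [[dq m_gt1]|[|/mapP[H]]].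
- have [m1|m_le1] := ltnP 1 (multiplicity A q).
    by left; rewrite in_intersection_points // dq.
  right; have [qL m1] : (q <= L)%VS /\ multiplicity A q = 1.
    by move: m_gt1 m_le1; case: (q <= L)%VS; case: (multiplicity _ _) => [|[]].
  have /hasP[H HA qH] : has (fun H => q <= H)%VS A.
    by rewrite has_count -multiplicityE m1.
  have qE : q = (L :&: H)%VS.
    apply: point_eq; rewrite ?(generic_meet_dim data) ?subv_cap ?qL //.
    exact/eqP.
  apply/mapP; exists H => //; rewrite mem_filter HA andbT.
  apply: contra_eqN m1 => pH; move: ptsp.
  rewrite qE (generic_meet_center data) // in_intersection_points //.
  by case/andP=> _; rewrite ltn_neqAle eq_sym => /andP[].
- rewrite in_intersection_points // => /andP[-> m_gt1]; split=> //.
  exact: leq_trans (leq_addl _ _).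
- rewrite mem_filter => /andP[pH HA] ->.
  by rewrite (generic_meet_dim data) // capvSl multiplicity_new_point.
Qed.

(** The multiplicity at p goes from m' to m' + 1, and d' - m' double points are
    created; the lost term F m' stands on the left, as F takes values in nat. *)
Lemma point_sum_extension F :
  point_sum (L |` A)%fset F + F (multiplicity A p) =
  point_sum A F + F (multiplicity A p).+1 + (#|` A| - multiplicity A p) * F 2.
Proof.
case: (data) => _ _ [ptsp _] [_ LA pL gen].
rewrite /point_sum (perm_big _ extension_intersection_points) big_cat /=.
rewrite (bigD1_seq p) ?fset_uniq //= [in RHS](bigD1_seq p) ?fset_uniq //=.
rewrite (multiplicity_extension data) pL add1n big_map big_filter.
rewrite -count_avoiding -sum1_count big_distrl /=.
rewrite [X in F _.+1 + X](_ : _ =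
  \sum_(q <- intersection_points A | q != p) F (multiplicity A q)).
  rewrite [X in _ + X + F _](_ : _ = \sum_(H <- A | ~~ (p <= H)%VS) 1 * F 2).
    set X := \sum_(q <- _ | _) _; set Y := \sum_(H <- _ | _) _.
    by clearbody X Y; lia.
  rewrite big_seq_cond [RHS]big_seq_cond; apply: eq_bigr => H /andP[HA pH].
  by rewrite (multiplicity_extension data) capvSl multiplicity_new_point ?mul1n.
rewrite big_seq_cond [RHS]big_seq_cond; apply: eq_bigr => q /andP[qA neq].
rewrite (multiplicity_extension data); case qL: (q <= L)%VS => //.
by move: neq; rewrite (gen q) ?eqxx.
Qed.

Lemma tjurina_extension :
  tjurina (L |` A)%fset = tjurina A + #|` A| + multiplicity A p - 1.
Proof.
have [_ _ arrA] := generic_dims data.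
have arrLA := arrangement_extension data.
have tE B : line_arrangement B -> tjurina B = point_sum B (fun m => (m - 1) ^ 2).
  by move=> arrB; rewrite (point_sum_npoints _ arrB (ltnSn _)).
rewrite !tE //; have := point_sum_extension (fun m => (m - 1) ^ 2).
have := multiplicity_le_card A p.
have : 1 < multiplicity A p.
  case: (data) => _ _ [+ _] _.
  by rewrite in_intersection_points // => /andP[].
move: (multiplicity A p) (#|` A|) (point_sum _ _) (point_sum _ _).
case=> [|[|m]] // d S1 S2 _ le; rewrite !subSS !subn0 -!mulnn.
nia.
Qed.

End Extension.

(** The number d (d - 1) of ordered pairs of lines is a sum over the points. *)
Lemma same_weak_card A B : line_arrangement A -> line_arrangement B ->
  same_weak_combinatorics A B -> 0 < #|` A| -> 0 < #|` B| -> #|` A| = #|` B|.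
Proof.
move=> arrA arrB AB.
have := same_weak_point_sum (fun m => m * m.-1) arrA arrB AB.
rewrite !point_sum_pairs //; move: (#|` A|) (#|` B|) => [|a] [|b] //=; nia.
Qed.

(** m' is the largest j with n_j > 0. *)
Lemma same_weak_multiplicity A B p q L M :
  generic_extension_data A p L -> generic_extension_data B q M ->
  same_weak_combinatorics A B -> multiplicity A p <= multiplicity B q.
Proof.
move=> dataA dataB AB.
case: (dataA) => arrA _ [pA _] _; case: (dataB) => arrB _ [qB maxq] _.
have m_gt1 : 1 < multiplicity A p.
  by move: pA; rewrite in_intersection_points // => /andP[].
have : 0 < npoints B (multiplicity A p).
  rewrite -AB // /npoints card_fset_count -has_count; apply/hasP; exists p => //=.
rewrite /npoints card_fset_count -has_count => /hasP[q' q'B /eqP <-].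
exact: maxq.
Qed.

Lemma same_weak_extension A B p q L M :
  generic_extension_data A p L -> generic_extension_data B q M ->
  same_weak_combinatorics A B ->
  same_weak_combinatorics (L |` A)%fset (M |` B)%fset.
Proof.
move=> dataA dataB AB j j_gt1.
have BA : same_weak_combinatorics B A by move=> i i_gt1; rewrite AB.
case: (dataA) => arrA _ [pA _] _; case: (dataB) => arrB _ [qB maxq] _.
have em : multiplicity A p = multiplicity B q.
  apply/eqP; rewrite eqn_leq (same_weak_multiplicity dataA dataB AB).
  exact: (same_weak_multiplicity dataB dataA BA).
have ed : #|` A| = #|` B|.
  apply: same_weak_card => //.
    exact: leq_trans (avoiding_gt0 dataA) (leq_subr _ _).
  exact: leq_trans (avoiding_gt0 dataB) (leq_subr _ _).
pose F m : nat := m == j; rewrite !npoints_point_sum.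
apply: (@addIn (F (multiplicity A p))); rewrite (point_sum_extension dataA).
by rewrite (same_weak_point_sum F arrA arrB AB) em ed -(point_sum_extension dataB).
Qed.

End WeakCombinatorics.

(** * Intersection lattices *)

Section Combinatorics.

Variable K : fieldType.
Implicit Types (A B S T : {fset subspace3 K}) (H X Y p q L M : subspace3 K).
Implicit Types (phi sigma : subspace3 K -> subspace3 K).

Definition meet S : subspace3 K := (\bigcap_(H <- enum_fset S) H)%VS.

Lemma sub_meetP X S :
  reflect {in S, forall H, (X <= H)%VS} (X <= meet S)%VS.
Proof.
rewrite /meet; apply: (iffP idP) => [le H HS|le].
  apply: subv_trans le _; rewrite (bigD1_seq H) ?fset_uniq //; exact: capvSl.
rewrite big_seq; elim/big_rec: _ => [|H Y HS XY]; first exact: subvf.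
by rewrite subv_cap le.
Qed.

Lemma meet_sub S H : H \in S -> (meet S <= H)%VS.
Proof. by apply/sub_meetP; rewrite subvv. Qed.

Lemma subv_anti X Y : (X <= Y)%VS -> (Y <= X)%VS -> X = Y.
Proof. by move=> XY YX; apply/eqP; rewrite eqEsubv XY. Qed.

Lemma meet0 : meet fset0 = fullv.
Proof. by apply: subv_anti; rewrite ?subvf //; apply/sub_meetP. Qed.

Lemma meet1 H : meet [fset H]%fset = H.
Proof.
apply: subv_anti; first by apply: meet_sub; rewrite inE.
by apply/sub_meetP => H'; rewrite inE => /eqP ->.
Qed.

Lemma meetU1 H S : meet (H |` S)%fset = (H :&: meet S)%VS.
Proof.
apply: subv_anti.
  rewrite subv_cap meet_sub ?fset1U1 //=; apply/sub_meetP => H' H'S.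
  by apply: meet_sub; rewrite fset1Ur.
apply/sub_meetP => H' /fset1UP[->|H'S]; first exact: capvSl.
exact: subv_trans (capvSr _ _) (meet_sub H'S).
Qed.

Lemma in_latticeP A X :
  reflect (exists2 S, (S `<=` A)%fset & X = meet S) (X \in intersection_lattice A).
Proof.
apply: (iffP (imfsetP _ _ _ _)) => -[S]; rewrite /= ?fpowersetE => SA ->.
  by exists S; rewrite // -fpowersetE.
by exists S; rewrite //= fpowersetE.
Qed.

Lemma meet_in_lattice A S : (S `<=` A)%fset -> meet S \in intersection_lattice A.
Proof. by move=> SA; apply/in_latticeP; exists S. Qed.

Lemma line_in_lattice A H : H \in A -> H \in intersection_lattice A.
Proof. by move=> HA; rewrite -[H]meet1 meet_in_lattice ?fsub1set. Qed.

Lemma lattice_line_eq A X H : line_arrangement A -> X \in intersection_lattice A ->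
  X != fullv -> H \in A -> (H <= X)%VS -> X = H.
Proof.
move=> arrA /in_latticeP[S SA ->] nT HA le.
have [e|[H' H'S]] := fset_0Vmem S; first by rewrite e meet0 eqxx in nT.
have le' := meet_sub H'S.
have e : H = H'.
  by apply: line_eq; [exact: arrA|exact/arrA/(fsubsetP SA)|exact: subv_trans le le'].
by apply: subv_anti; rewrite // e.
Qed.

(** The lattice is that of the closed sets of lines, where H is in the closure of S
    when it contains the intersection of S. A lattice isomorphism is thus the same
    thing as a bijection of the lines that preserves closures; such a bijection is
    easier to extend by L. *)
Definition line_isomorphism A B sigma :=
  [/\ {in A, forall H, sigma H \in B},
      {in B, forall H, exists2 G, G \in A & H = sigma G}
    & forall S H, (S `<=` A)%fset -> H \in A ->
        (meet S <= H)%VS = (meet [fset sigma G | G in S]%fset <= sigma H)%VS].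

Lemma image_subset A B sigma S : {in A, forall H, sigma H \in B} ->
  (S `<=` A)%fset -> ([fset sigma G | G in S] `<=` B)%fset.
Proof.
move=> AB /fsubsetP SA; apply/fsubsetP => _ /imfsetP[G /= GS ->].
by apply/AB/SA.
Qed.

(** The lines are the maximal elements of the lattice other than the whole space,
    hence are matched by an isomorphism, which also preserves infima. *)
Lemma lattice_isomorphism_lines A B phi :
  line_arrangement A -> line_arrangement B -> lattice_isomorphism A B phi ->
  line_isomorphism A B phi /\
  forall S, (S `<=` A)%fset -> phi (meet S) = meet [fset phi G | G in S]%fset.
Proof.
move=> arrA arrB [inj img mono].
have phiL X : X \in intersection_lattice A -> phi X \in intersection_lattice B.
  by move=> XA; rewrite -img; apply/imfsetP; exists X.
have phi_onto Y : Y \in intersection_lattice B ->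
    exists2 X, X \in intersection_lattice A & Y = phi X.
  by rewrite -img => /imfsetP[X /= XA ->]; exists X.
have TL (C : {fset subspace3 K}) : fullv \in intersection_lattice C.
  by rewrite -meet0 meet_in_lattice ?fsub0set.
have phiT : phi fullv = fullv.
  have [X XA e] := phi_onto _ (TL B).
  by apply: subv_anti; rewrite ?subvf // {1}e mono ?TL ?subvf.
have lineT H : \dim H = 2%N -> H != fullv.
  by move=> dH; apply: contra_eqN dH => /eqP ->; rewrite dim_space3.
have phiTE X : X \in intersection_lattice A -> X != fullv -> phi X != fullv.
  by move=> XA; apply: contraNN; rewrite -{1}phiT => /eqP/inj ->.
have ltT X (C : {fset subspace3 K}) : 
    X \in intersection_lattice C -> X != fullv ->
    exists2 H, H \in C & (X <= H)%VS.
  move=> /in_latticeP[S SC ->] nT.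
  have [e|[H HS]] := fset_0Vmem S; first by rewrite e meet0 eqxx in nT.
  by exists H; [exact: (fsubsetP SC)|exact: meet_sub].
have AB : {in A, forall H, phi H \in B}.
  move=> H HA; have HL := line_in_lattice HA.
  have [G GB le] := ltT _ _ (phiL _ HL) (phiTE _ HL (lineT _ (arrA _ HA))).
  have [X XA e] := phi_onto _ (line_in_lattice GB).
  suff <- : X = H by rewrite -e.
  apply: (lattice_line_eq arrA) => //; last by rewrite -mono // -e.
  by apply: contraNneq (lineT _ (arrB _ GB)) => XT; rewrite e XT phiT.
have phi_meet S : (S `<=` A)%fset -> phi (meet S) = meet [fset phi G | G in S]%fset.
  move=> SA; have mS := meet_in_lattice SA.
  apply: subv_anti.
    apply/sub_meetP => _ /imfsetP[G /= GS ->].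
    by rewrite mono ?meet_sub // line_in_lattice // (fsubsetP SA).
  have [X XA e] := phi_onto _ (meet_in_lattice (image_subset AB SA)).
  rewrite e mono //; apply/sub_meetP => H HS.
  rewrite -(mono _ _ XA (line_in_lattice (fsubsetP SA _ HS))) -e meet_sub //.
  by apply/imfsetP; exists H.
split=> //; split=> // [H HB|S H SA HA].
  have HL := line_in_lattice HB; have [X XA e] := phi_onto _ HL.
  have [G GA le] : exists2 H, H \in A & (X <= H)%VS.
    apply: ltT => //; apply: contraNneq (lineT _ (arrB _ HB)) => XT.
    by rewrite e XT phiT.
  exists G => //; apply: line_eq; rewrite ?arrB ?AB //.
  by rewrite e mono // line_in_lattice.
by rewrite -phi_meet // mono ?meet_in_lattice ?line_in_lattice.
Qed.

(** Send X to the intersection of the images of the lines containing X. *)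
Lemma line_isomorphism_combinatorics A B sigma :
  line_isomorphism A B sigma -> same_combinatorics A B.
Proof.
move=> [AB onto eqc].
pose cl X := [fset H in A | (X <= H)%VS]%fset.
pose phi X := meet [fset sigma G | G in cl X]%fset.
have phi_meet S : (S `<=` A)%fset -> phi (meet S) = meet [fset sigma G | G in S]%fset.
  move=> SA; apply: subv_anti.
    apply/sub_meetP => _ /imfsetP[G /= GS ->]; apply: meet_sub.
    by apply/imfsetP; exists G; rewrite //= !inE (fsubsetP SA) //= meet_sub.
  apply/sub_meetP => _ /imfsetP[G /= + ->].
  by rewrite !inE /= => /andP[GA le]; rewrite -eqc.
have mono : {in intersection_lattice A &, {mono phi : X Y / (X <= Y)%VS}}.
  move=> _ _ /in_latticeP[S SA ->] /in_latticeP[T TA ->].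
  rewrite !phi_meet //; apply/sub_meetP/sub_meetP => le.
    by move=> H HT; rewrite eqc ?(fsubsetP TA) //; apply: le; apply/imfsetP; exists H.
  by move=> _ /imfsetP[H /= HT ->]; rewrite -eqc ?(fsubsetP TA) // le.
exists phi; split=> //.
  by move=> X Y XA YA e; apply: subv_anti; rewrite -mono // e subvv.
apply/fsetP => Z; apply/imfsetP/in_latticeP => /=.
  case=> _ /in_latticeP[S SA ->] ->.
  by exists [fset sigma G | G in S]%fset; [exact: image_subset AB SA|exact: phi_meet].
case=> T TB ->.
pose S := [fset H in A | sigma H \in T]%fset.
have SA : (S `<=` A)%fset by apply/fsubsetP => H; rewrite !inE => /andP[].
exists (meet S); first exact: meet_in_lattice.
rewrite phi_meet //; congr meet; apply/fsetP => G; apply/idP/imfsetP => /= [GT|[H]].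
  have [H HA e] := onto _ (fsubsetP TB _ GT).
  by exists H; rewrite // !inE HA -e.
by rewrite !inE => /andP[_ HT] ->.
Qed.

Section GenericMeets.

Variables (A : {fset subspace3 K}) (p L : subspace3 K).
Hypothesis data : generic_extension_data A p L.

Lemma center_meet : exists2 S, (S `<=` A)%fset & p = meet S.
Proof.
case: (data) => _ _ [/imfsetP pts _] _; case: pts => -[H1 H2] /=.
rewrite !inE /= => /andP[/andP[H1A H2A] _] ->.
exists [fset H1; H2]%fset; last by rewrite meetU1 meet1.
by apply/fsubsetP => H /fset2P[] ->.
Qed.

(** An intersection of lines of A contained in L is either an intersection point of
    A on L, which can only be p, or zero. *)
Lemma meet_le_generic S : (S `<=` A)%fset -> (meet S <= L)%VS = (meet S <= p)%VS.
Proof.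
move=> SA; have [dp dL dA] := generic_dims data.
case: (data) => arrA _ _ [_ LA pL gen].
apply/idP/idP => [le|le]; last exact: subv_trans le pL.
have [e|[H1 H1S]] := fset_0Vmem S.
  have := dimvS le; rewrite e meet0 dL dim_space3 //.
have H1A := fsubsetP SA _ H1S.
have [e|[H2]] := fset_0Vmem (S `\ H1)%fset.
  have mE : meet S = H1 by rewrite -(fsetD1K H1S) e meetU1 meet0 capvf.
  case/negP: LA; rewrite -(_ : H1 = L) //; apply: line_eq => //; first exact: dA.
  by rewrite -mE.
rewrite !inE => /andP[neq H2S]; have H2A := fsubsetP SA _ H2S.
have le12 : (meet S <= H1 :&: H2)%VS by rewrite subv_cap !meet_sub.
have d12 : \dim (H1 :&: H2)%VS = 1%N by apply: dim_meet; rewrite ?dA // eq_sym.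
have [|dS] := posnP (\dim (meet S)).
  by move/eqP; rewrite dimv_eq0 => /eqP ->; exact: sub0v.
have e : meet S = (H1 :&: H2)%VS by apply/eqP; rewrite eqEdim le12 d12.
rewrite (gen (meet S)) // e; apply: meet_intersection_point => //.
by rewrite eq_sym.
Qed.

(** In terms of lines of A and incidence with p only: for S nonempty, the
    intersection of L with the lines of S is p when these all pass through p, the
    new point on G when S consists of a single line G avoiding p, and zero
    otherwise. *)
Lemma generic_meet_leP S H : (S `<=` A)%fset -> H \in A ->
  (L :&: meet S <= H)%VS <->
  [\/ H \in S,
      [/\ exists G, G \in S, {in S, forall G, (p <= G)%VS} & (p <= H)%VS]
    | exists G G', [/\ G \in S, G' \in S, G != G' & ~~ (p <= G)%VS]].
Proof.
move=> SA HA; have [dp dL dA] := generic_dims data.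
have pL : (p <= L)%VS by case: data => _ _ _ [].
have leLG G : G \in S -> (L :&: meet S <= L :&: G)%VS.
  by move=> GS; apply: capvS => //; exact: meet_sub.
split=> [le|]; last first.
  case=> [HS|[[G GS] pS pH]|[G [G' [GS G'S neq pG]]]].
  - exact: subv_trans (capvSr _ _) (meet_sub HS).
  - apply: subv_trans (leLG _ GS) _; rewrite (generic_meet_center data) //.
      exact: (fsubsetP SA).
    exact: pS.
  - have [GA G'A] := (fsubsetP SA _ GS, fsubsetP SA _ G'S).
    have [d0|d_gt0] := posnP (\dim (L :&: meet S)%VS).
      by move/eqP: d0; rewrite dimv_eq0 => /eqP ->; exact: sub0v.
    have e : (L :&: meet S)%VS = (L :&: G)%VS.
      by apply/eqP; rewrite eqEdim leLG // (generic_meet_dim data).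
    case/negP: pG; have := leLG _ G'S; rewrite e subv_cap => /andP[_ le'].
    by have [] := generic_meet_shared data GA G'A neq le'.
have [e|[G0 G0S]] := fset_0Vmem S.
  move: le; rewrite e meet0 capvf => le.
  have eLH : L = H by apply: line_eq => //; exact: dA.
  by move: (generic_neq data HA); rewrite eLH eqxx.
have [/hasP[G GS pG]|/hasPn pS] := boolP (has (fun G => ~~ (p <= G)%VS) S); last first.
  have {}pS : {in S, forall G, (p <= G)%VS} by move=> G /pS/negPn.
  apply: Or32; split=> //; first by exists G0.
  by apply: subv_trans le; rewrite subv_cap pL; apply/sub_meetP.
have GA := fsubsetP SA _ GS.
have [e|[G']] := fset_0Vmem (S `\ G)%fset; last first.
  rewrite !inE => /andP[neq G'S]; apply: Or33; exists G, G'; split=> //.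
  by rewrite eq_sym.
move: le; rewrite -(fsetD1K GS) e meetU1 meet0 capvf => le.
have [->|neq] := eqVneq H G; first by apply: Or31; rewrite !inE eqxx.
case/negP: pG; rewrite eq_sym in neq.
by have [] := generic_meet_shared data GA HA neq le.
Qed.

End GenericMeets.

(** The bijection of lines is extended by sending L to M. Closures are preserved by
    [meet_le_generic] and [generic_meet_leP], whose right-hand sides only involve
    the lattice of A and the element p of it. *)
Lemma same_combinatorics_extension A B p q L M :
  generic_extension_data A p L -> generic_extension_data B q M ->
  same_pointed_combinatorics A p B q ->
  same_combinatorics (L |` A)%fset (M |` B)%fset.
Proof.
move=> dataA dataB [phi [iso phip]].
have [_ _ arrA] := generic_dims dataA; have [_ _ arrB] := generic_dims dataB.
have [[AB onto eqc] phi_meet] := lattice_isomorphism_lines arrA arrB iso.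
have [_ _ mono] := iso.
have LA : L \notin A by case: dataA => _ _ _ [].
have [P PA pE] := center_meet dataA.
have pLat : p \in intersection_lattice A by rewrite pE meet_in_lattice.
have phi_inj : {in A &, injective phi}.
  by move=> G H GA HA; case: iso => inj _ _; apply: inj; rewrite line_in_lattice.
have pq H : H \in A -> (p <= H)%VS = (q <= phi H)%VS.
  by move=> HA; rewrite -phip mono // line_in_lattice.
pose sigma H := if H == L then M else phi H.
have sL : sigma L = M by rewrite /sigma eqxx.
have sA H : H \in A -> sigma H = phi H.
  by move=> HA; rewrite /sigma; case: eqP HA => // ->; rewrite (negPf LA).
have sS S : (S `<=` A)%fset ->
    [fset sigma G | G in S]%fset = [fset phi G | G in S]%fset.
  by move=> /fsubsetP SA; apply: eq_in_imfset => G /= GS; apply/sA/SA.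
apply: (@line_isomorphism_combinatorics _ _ sigma); split.
- move=> H /fset1UP[->|HA]; first by rewrite sL fset1U1.
  by rewrite (sA _ HA); apply/fset1Ur/AB.
- move=> H /fset1UP[->|/onto[G GA ->]]; first by exists L; [exact: fset1U1|rewrite sL].
  by exists G; [exact: fset1Ur|rewrite sA].
move=> S H SLA HLA.
have SDA : (S `\ L `<=` A)%fset by rewrite fsubDset.
have [LS|LS] := boolP (L \in S); last first.
  have {SLA SDA} SA : (S `<=` A)%fset.
    apply/fsubsetP => G GS; apply: (fsubsetP SDA); rewrite !inE GS andbT.
    by apply: contraNneq LS => <-.
  rewrite sS //; case/fset1UP: HLA => [->|HA]; last by rewrite sA // eqc.
  rewrite sL (meet_le_generic dataA) // (meet_le_generic dataB).
    by rewrite -phi_meet // -phip mono // meet_in_lattice.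
  exact: image_subset AB _.
rewrite -(fsetD1K LS); move: SDA; move: (S `\ L)%fset => S' S'A.
rewrite imfsetU1 sL sS // !meetU1.
case/fset1UP: HLA => [->|HA]; first by rewrite sL !capvSl.
have S'B := image_subset AB S'A; have S'P := fsubsetP S'A.
rewrite sA //; apply/idP/idP.
- move/(generic_meet_leP dataA S'A HA) => alt.
  apply/(generic_meet_leP dataB S'B (AB _ HA)).
  case: alt => [HS|[[G GS] pS pH]|[G [G' [GS G'S neq pG]]]].
  + by apply: Or31; apply/imfsetP; exists H.
  + apply: Or32; split; last by rewrite -pq.
      by exists (phi G); apply/imfsetP; exists G.
    by move=> _ /imfsetP[F /= FS ->]; rewrite -pq ?pS // S'P.
  + apply: Or33; exists (phi G), (phi G'); split; rewrite -?pq ?S'P //.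
    * by apply/imfsetP; exists G.
    * by apply/imfsetP; exists G'.
    * by apply: contraNneq neq => /phi_inj ->; rewrite ?S'P.
- move/(generic_meet_leP dataB S'B (AB _ HA)) => alt.
  apply/(generic_meet_leP dataA S'A HA).
  case: alt => [/imfsetP[G /= GS e]|[[_ /imfsetP[G /= GS _]] pS qH]|].
  + by apply: Or31; rewrite (phi_inj _ _ HA _ e) // S'P.
  + apply: Or32; split; [by exists G| |by rewrite pq].
    by move=> F FS; rewrite pq ?S'P // pS //; apply/imfsetP; exists F.
  + move=> [_ [_ [/imfsetP[G /= GS ->] /imfsetP[G' /= G'S ->] neq qG]]].
    apply: Or33; exists G, G'; split=> //; last by rewrite pq ?S'P.
    by apply: contraNneq neq => ->.
Qed.

End Combinatorics.

(** * The theorem *)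

Theorem proposition4p14 (K : fieldType) (charK : [pchar K] =i pred0)
    (A' A : {fset {vspace 'rV[K]_3}}) (p L : {vspace 'rV[K]_3})
    (f' f : {mpoly K[3]}) (d' m' r' r : nat)
    (hA' : generic_extension_data A' p L)
    (hA : A = (L |` A')%fset)
    (hf' : defining_polynomial A' f') (hf : defining_polynomial A f)
    (hd' : d' = #|` A'|) (hm' : m' = multiplicity A' p)
    (hr' : minimal_syzygy_degree f' r') (hr : minimal_syzygy_degree f r) :
  [/\ [/\ forall (B' : {fset {vspace 'rV[K]_3}}) (q M : {vspace 'rV[K]_3}),
            generic_extension_data B' q M ->
            same_weak_combinatorics A' B' ->
            same_weak_combinatorics A (M |` B')%fset,
          forall (B' : {fset {vspace 'rV[K]_3}}) (q M : {vspace 'rV[K]_3}),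
            generic_extension_data B' q M ->
            same_pointed_combinatorics A' p B' q ->
            same_combinatorics A (M |` B')%fset
        & tjurina A = (tjurina A' + d' + m' - 1)%N],
      (r' < d' - m')%N -> r = (r' + 1)%N
    & r' = (d' - m')%N -> r = r'].
Proof.
subst A d' m'; have bounds := minimal_degree_bounds charK hA' hf' hf hr' hr.
split.
- split.
  + by move=> B' q M hB'; apply: same_weak_extension hA' hB'.
  + by move=> B' q M hB'; apply: same_combinatorics_extension hA' hB'.
  + exact: tjurina_extension.
- move=> lt; have neq := minimal_degree_increases charK hA' hf' hf hr' hr lt.
  apply/eqP; rewrite addn1 eqn_leq; case/andP: bounds => le ->.
  by rewrite ltn_neqAle eq_sym neq.
- move=> e; have le := minimal_degree_le_avoiding charK hA' hf hr.
  by apply/eqP; rewrite eqn_leq {1}e le; case/andP: bounds.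
Qed.
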